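(* Let $\Lambda$ be an Artin algebra, let $X$ be an additive generator in $\operatorname{mod}(\Lambda)$ and let $F:=F_{\operatorname{add}(X)}$ be such that $\Lambda$ is $F$-admissible. Consider the following classes: (a) $F\text{-tor-preen}(\Lambda)$, whose elements are the nonzero preenveloping $F$-torsion classes in $\operatorname{mod}(\Lambda)$; (b) $F\text{-presilt-esp}(\Lambda)$, whose elements are the isomorphism classes $[M]$, with $M\in\operatorname{mod}(\Lambda)$ special $F$-presilting such that $\operatorname{gen}_F(M)$ is preenveloping. Then the map $[M]\mapsto\operatorname{gen}_F(M)$ induces a bijection between $F\text{-presilt-esp}(\Lambda)$ and $F\text{-tor-preen}(\Lambda)$.
   Context: $\operatorname{mod}(\Lambda)$ is the category of finitely generated left $\Lambda$-modules. $\operatorname{add}(M)$ is the class of direct summands of finite direct sums of copies of $M$; $\operatorname{gen}(M)$ is the class of epimorphic images of finite direct sums of copies of $M$. An additive generator in $\operatorname{mod}(\Lambda)$ is a module $X$ with $\operatorname{gen}(X)=\operatorname{mod}(\Lambda)$. A module $M$ is basic if $M\ne 0$ and the summands in its decomposition into indecomposables are pairwise non-isomorphic. $F_{\operatorname{add}(X)}$ is the additive subfunctor of $\operatorname{Ext}^1_\Lambda$ such that $F_{\operatorname{add}(X)}(C,A)$ consists of the exact sequences $\eta:0\to A\to B\to C\to 0$ with $\operatorname{Hom}_\Lambda(Z,\eta)$ exact for all $Z\in\operatorname{add}(X)$; these sequences are called $F$-exact, and then $C$ is an $F$-quotient of $B$. The $F$-projective modules (those $P$ with $\operatorname{Hom}_\Lambda(P,\eta)$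 exact for every $F$-exact $\eta$) are exactly those in $\operatorname{add}(X)$, and $F$ has enough projectives. $\operatorname{Ext}^i_F(M,N)$ is the $i$-th cohomology of $\operatorname{Hom}_\Lambda(P_\bullet,N)$, where $P_\bullet$ is an $F$-projective resolution of $M$ (a resolution by $F$-projectives whose constituent short exact sequences are $F$-exact). $\operatorname{gen}_F(M)$ is the class of all $Z$ admitting an $F$-exact sequence $0\to K\to Y\to Z\to 0$ with $Y$ a finite direct sum of copies of $M$. A class $\mathcal{T}$ is $F$-torsion if it is closed under $F$-extensions (if $0\to A\to B\to C\to 0$ is $F$-exact with $A,C\in\mathcal{T}$ then $B\in\mathcal{T}$) and under $F$-quotients. A class $\mathcal{T}$ is preenveloping if every $M\in\operatorname{mod}(\Lambda)$ admits a morphism $f:M\to T'$ with $T'\in\mathcal{T}$ such that $\operatorname{Hom}_\Lambda(f,Z)$ is surjective for all $Z\in\mathcal{T}$. For each $M$ fix a minimal $F$-projective resolution $\cdots\to P^{-2}_F(M)\xrightarrow{\pi^{-2}_{F,M}}P^{-1}_F(M)\xrightarrow{\pi^{-1}_{F,M}}P^0_F(M)\xrightarrow{\pi^0_{F,M}}M\to 0$ (minimal: each map onto its image is right minimal). $\Lambda$ is $F$-admissible if, for any $M\in\operatorname{mod}(\Lambda)$, $\operatorname{Ext}^1_F(M,M)=0$ implies $\operatorname{Hom}_\Lambda(\pi^{-2}_{F,M},M)=0$ (i.e. precomposition with $\pi^{-2}_{F,M}$ is the zero map $\operatorname{Hom}_\Lambda(P^{-1}_F(M),M)\to\operatorname{Hom}_\Lambda(P^{-2}_F(M),M)$).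 $M$ is $F$-presilting if the complex $P^\bullet:=(P^{-1}_F(M)\xrightarrow{\pi^{-1}_{F,M}}P^0_F(M))$, concentrated in degrees $-1,0$, satisfies $\operatorname{Hom}_{\mathsf{K}^b(\operatorname{add}(X))}(P^\bullet,P^\bullet[i])=0$ for all $i>0$, where $\mathsf{K}^b(\operatorname{add}(X))$ is the bounded homotopy category of $\operatorname{add}(X)$. Let $\Gamma:=\operatorname{End}_\Lambda(X)^{op}$. For a class $\mathcal{U}=\operatorname{add}(\mathcal{U})\subseteq\operatorname{mod}(\Gamma)$ for which there are, up to isomorphism, only finitely many indecomposables $U_1,\dots,U_n\in\mathcal{U}$ with $\operatorname{Ext}^1_\Gamma(U_i,\mathcal{U})=0$, set $\mathbb{P}(\mathcal{U}):=\bigoplus_{i=1}^nU_i$. This applies to $\mathcal{U}=\operatorname{gen}(N)$ for any $\tau$-rigid $\Gamma$-module $N$ (that is, $\operatorname{Hom}_\Gamma(N,\tau N)=0$ with $\tau$ the Auslander–Reiten translation), and if $M$ is $F$-presilting then $\operatorname{Hom}_\Lambda(X,M)$ is $\tau$-rigid in $\operatorname{mod}(\Gamma)$. A module $M\in\operatorname{mod}(\Lambda)$ is special $F$-presilting if $M$ is basic, $F$-presilting, and for every nonzero $M'\in\operatorname{mod}(\Lambda)$ with $\operatorname{add}(M)\cap\operatorname{add}(M')=0$, the $\Gamma$-module $\operatorname{Hom}_\Lambda(X,M\oplus M')$ is not a direct summand of $\mathbb{P}(\operatorname{gen}(\operatorname{Hom}_\Lambda(X,M)))$. *)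

(* Defs.v *)
From HB Require Import structures.
From mathcomp Require Import all_boot all_order all_algebra.
From mathcomp Require Import boolp.

Set Implicit Arguments.
Unset Strict Implicit.
Unset Printing Implicit Defensive.

Import GRing.Theory Num.Theory.
Local Open Scope ring_scope.

Definition hom (R : pzRingType) (U V : lmodType R) := {linear U -> V}.

Section Hom.
Variable R : pzRingType.
Implicit Types U V W : lmodType R.

Lemma homP U V (f g : hom U V) : f =1 g -> f = g.
Proof.
move: f g => [f [[f1] [f2]]] [g [[g1] [g2]]] /= /funext fg.
move: fg f1 f2 g1 g2 => -> f1 f2 g1 g2.
by rewrite (Prop_irrelevance f1 g1) (Prop_irrelevance f2 g2).
Qed.

HB.instance Definition _ U V := gen_eqMixin (hom U V).
HB.instance Definition _ U V := gen_choiceMixin (hom U V).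

Definition hom0 U V : hom U V := \0 : {linear U -> V}.
Definition homN U V (f : hom U V) : hom U V := \- f : {linear U -> V}.
Definition homD U V (f g : hom U V) : hom U V := f \+ g : {linear U -> V}.
Definition hom1 U : hom U U := idfun : {linear U -> U}.
Definition homc U V W (f : hom V W) (g : hom U V) : hom U W :=
  f \o g : {linear U -> W}.

Lemma homDA U V : associative (@homD U V).
Proof. by move=> f g h; apply: homP => x /=; rewrite addrA. Qed.
Lemma homDC U V : commutative (@homD U V).
Proof. by move=> f g; apply: homP => x /=; rewrite addrC. Qed.
Lemma hom0D U V : left_id (@hom0 U V) (@homD U V).
Proof. by move=> f; apply: homP => x /=; rewrite add0r. Qed.
Lemma homND U V : left_inverse (@hom0 U V) (@homN U V) (@homD U V).
Proof. by move=> f; apply: homP => x /=; rewrite addNr. Qed.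

HB.instance Definition _ U V :=
  GRing.isZmodule.Build (hom U V) (@homDA U V) (@homDC U V) (@hom0D U V)
    (@homND U V).

Lemma homcA U V W T (f : hom W T) (g : hom V W) (h : hom U V) :
  homc f (homc g h) = homc (homc f g) h.
Proof. exact: homP. Qed.
Lemma hom1c U V (f : hom U V) : homc (hom1 V) f = f.
Proof. exact: homP. Qed.
Lemma homc1 U V (f : hom U V) : homc f (hom1 U) = f.
Proof. exact: homP. Qed.
Lemma homcDl U V W (f g : hom V W) (h : hom U V) :
  homc (f + g) h = homc f h + homc g h.
Proof. exact: homP. Qed.
Lemma homcDr U V W (f : hom V W) (g h : hom U V) :
  homc f (g + h) = homc f g + homc f h.
Proof. by apply: homP => x /=; rewrite raddfD. Qed.

(** The product of [endo X] is composition, so [(endo X)^c] is the ring written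
    [End(X)^op]; it acts on the left of [hom X M] by precomposition. *)

Definition endo U := hom U U.

HB.instance Definition _ U := GRing.Zmodule.on (endo U).
HB.instance Definition _ U :=
  GRing.Zmodule_isPzRing.Build (endo U) (fun f g h => homcA f g h)
    (@hom1c U U) (@homc1 U U) (fun f g h => homcDl f g h)
    (fun f g h => homcDr f g h).

Definition hom_act X M (a : (endo X)^c) (h : hom X M) : hom X M :=
  homc h (a : endo X).

Lemma hom_actA X M (a b : (endo X)^c) (h : hom X M) :
  hom_act a (hom_act b h) = hom_act (a * b) h.
Proof. exact: homP. Qed.
Lemma hom_act1 X M : left_id 1 (@hom_act X M).
Proof. by move=> h; apply: homP. Qed.
Lemma hom_actDr X M : right_distributive (@hom_act X M) +%R.
Proof. by move=> a g h; apply: homP. Qed.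
Lemma hom_actDl X M (h : hom X M) :
  {morph (@hom_act X M)^~ h : a b / a + b}.
Proof. by move=> a b; apply: homP => x /=; rewrite raddfD. Qed.

HB.instance Definition _ X M :=
  GRing.Zmodule_isLmodule.Build (endo X)^c (hom X M)
    (@hom_actA X M) (@hom_act1 X M) (@hom_actDr X M) (@hom_actDl X M).

End Hom.

Definition dsum (R : pzRingType) n (M : 'I_n -> lmodType R) :=
  {dffun forall i, M i}.

Section Dsum.
Variables (R : pzRingType) (n : nat) (M : 'I_n -> lmodType R).
Implicit Types f g h : dsum M.

HB.instance Definition _ := Choice.on (dsum M).

Definition dsum0 : dsum M := [ffun i => 0].
Definition dsumN f : dsum M := [ffun i => - f i].
Definition dsumD f g : dsum M := [ffun i => f i + g i].
Definition dsumZ (a : R) f : dsum M := [ffun i => a *: f i].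

Lemma dsumDA : associative dsumD.
Proof. by move=> f g h; apply/ffunP => i; rewrite !ffunE addrA. Qed.
Lemma dsumDC : commutative dsumD.
Proof. by move=> f g; apply/ffunP => i; rewrite !ffunE addrC. Qed.
Lemma dsum0D : left_id dsum0 dsumD.
Proof. by move=> f; apply/ffunP => i; rewrite !ffunE add0r. Qed.
Lemma dsumND : left_inverse dsum0 dsumN dsumD.
Proof. by move=> f; apply/ffunP => i; rewrite !ffunE addNr. Qed.

HB.instance Definition _ :=
  GRing.isZmodule.Build (dsum M) dsumDA dsumDC dsum0D dsumND.

Lemma dsumZA a b f : dsumZ a (dsumZ b f) = dsumZ (a * b) f.
Proof. by apply/ffunP => i; rewrite !ffunE scalerA. Qed.
Lemma dsum1Z : left_id 1 dsumZ.
Proof. by move=> f; apply/ffunP => i; rewrite !ffunE scale1r. Qed.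
Lemma dsumZDr : right_distributive dsumZ +%R.
Proof. by move=> a f g; apply/ffunP => i; rewrite !ffunE scalerDr. Qed.
Lemma dsumZDl f : {morph dsumZ^~ f : a b / a + b}.
Proof. by move=> a b; apply/ffunP => i; rewrite !ffunE scalerDl. Qed.

HB.instance Definition _ :=
  GRing.Zmodule_isLmodule.Build R (dsum M) dsumZA dsum1Z dsumZDr dsumZDl.

End Dsum.

Definition is_ideal (k : comNzRingType) (I : k -> Prop) : Prop :=
  [/\ I 0, forall x y, I x -> I y -> I (x + y) & forall a x, I x -> I (a * x)].

Definition artinian (k : comNzRingType) : Prop :=
  forall I : nat -> k -> Prop,
    (forall n, is_ideal (I n)) -> (forall n x, I n.+1 x -> I n x) ->
    exists n, forall m, (n <= m)%N -> forall x, I n x -> I m x.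

Definition finitely_generated (R : pzRingType) (M : lmodType R) : Prop :=
  exists n (g : 'I_n -> M),
    forall x, exists a : 'I_n -> R, x = \sum_(i < n) a i *: g i.

Definition artin_algebra (k : comNzRingType) (L : algType k) : Prop :=
  artinian k /\ finitely_generated (L : lmodType k).

Record fgmod (R : pzRingType) := Fgmod {
  fgmod_mod :> lmodType R;
  fgmodP : finitely_generated fgmod_mod }.

(** Not [set (fgmod R)]: the library forces the universe of [set] to lie strictly
    below that of [lmodType]. *)
Definition mclass (R : pzRingType) := fgmod R -> Prop.

Section Modules.
Variable R : pzRingType.
Implicit Types (M N U V : lmodType R) (T : mclass R).

Definition is_zero M : Prop := forall x : M, x = 0.

Definition isomorphic M N : Prop := exists f : hom M N, bijective f.

Definition isoclass M : mclass R := fun N : fgmod R => isomorphic M N.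

Definition direct_summand M N : Prop :=
  exists M' : lmodType R, isomorphic N (M * M')%type.

Definition indecomposable M : Prop :=
  ~ is_zero M /\
  forall A B : lmodType R, isomorphic M (A * B)%type -> is_zero A \/ is_zero B.

Definition power n M : lmodType R := dsum (fun _ : 'I_n => M).

Definition add M : mclass R :=
  fun N : fgmod R => exists n, direct_summand N (power n M).

Definition gen M : mclass R :=
  fun N : fgmod R => exists n (g : hom (power n M) N), forall y, exists x, g x = y.

Definition additive_generator (X : fgmod R) : Prop :=
  forall M : fgmod R, gen X M.

Definition basic M : Prop :=
  ~ is_zero M /\
  exists n (V : 'I_n -> lmodType R),
    [/\ forall i, indecomposable (V i),
        forall i j, i != j -> ~ isomorphic (V i) (V j)
      & isomorphic M (dsum V)].

Definition preenveloping T : Prop :=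
  forall M : fgmod R, exists (T' : fgmod R) (f : hom M T'),
    T T' /\ forall Z : fgmod R, T Z ->
      forall h : hom M Z, exists h' : hom T' Z, homc h' f = h.

End Modules.

Definition short_exact (A B C : zmodType) (f : A -> B) (g : B -> C) : Prop :=
  [/\ injective f,
      forall b, g b = 0 <-> exists a, f a = b
    & forall c, exists b, g b = c].

Section ExtProjectives.
Variable R : pzRingType.

(** Vanishing of the Yoneda group: every extension of [C] by [A] splits. *)
Definition ext1_eq0 (C A : fgmod R) : Prop :=
  forall (B : fgmod R) (f : hom A B) (g : hom B C), short_exact f g ->
    exists s : hom C B, homc g s = hom1 C.

(** [is_PP U P]: there are, up to isomorphism, only finitely many
    indecomposables [V_1, ..., V_n] in [U] with [Ext^1(V_i, U) = 0], and [P]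
    is isomorphic to their direct sum. *)
Definition is_PP (U : mclass R) (P : lmodType R) : Prop :=
  let ext_proj (W : fgmod R) :=
    [/\ U W, indecomposable W & forall A, U A -> ext1_eq0 W A] in
  exists n (V : 'I_n -> fgmod R),
    [/\ forall i, ext_proj (V i),
        forall i j, i != j -> ~ isomorphic (V i) (V j),
        forall W, ext_proj W -> exists i, isomorphic W (V i)
      & isomorphic P (dsum (fun i => V i : lmodType R))].

End ExtProjectives.

Section Complexes.
Variable R : pzRingType.

(** Cohomological complexes; the components [d i j] with [j != i + 1] are
    junk that is required to vanish, so that no transport along equalities
    between integers is needed. *)
Record complex := Complex {
  cobj :> int -> lmodType R;
  cd : forall i j, hom (cobj i) (cobj j);
  cd_eq0 : forall i j, j != i + 1 -> cd i j = 0;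
  cdd : forall i j k, homc (cd j k) (cd i j) = 0 }.

Definition chain_map (C D : complex) (f : forall i, hom (C i) (D i)) : Prop :=
  forall i j, homc (cd D i j) (f i) = homc (f j) (cd C i j).

Definition null_homotopic (C D : complex) (f : forall i, hom (C i) (D i)) :
    Prop :=
  exists s : forall i j, hom (C i) (D j), forall i,
    f i = homc (cd D (i - 1) i) (s i (i - 1))
        + homc (s (i + 1) i) (cd C i (i + 1)).

(** [Hom_K(C, D) = 0], for [K] the homotopy category. *)
Definition homK_eq0 (C D : complex) : Prop :=
  forall f : forall i, hom (C i) (D i), chain_map f -> null_homotopic f.

Section Shift.
Variables (C : complex) (n : int).

Definition shift_cd i j : hom (C (i + n)) (C (j + n)) :=
  if odd `|n|%N then - cd C (i + n) (j + n) else cd C (i + n) (j + n).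

Lemma shift_cd_eq0 i j : j != i + 1 -> shift_cd i j = 0.
Proof.
move=> ne; rewrite /shift_cd cd_eq0 ?oppr0 ?if_same //.
by rewrite addrAC (inj_eq (addIr _)).
Qed.

Lemma shift_cdd i j k : homc (shift_cd j k) (shift_cd i j) = 0.
Proof.
have dd x : cd C (j + n) (k + n) (cd C (i + n) (j + n) x) = 0.
  exact: (congr1 (fun f : hom _ _ => f x) (cdd C _ _ _)).
apply: homP => x; rewrite /shift_cd /=.
by case: ifP => _ /=; rewrite ?raddfN /= dd ?oppr0.
Qed.

Definition shift : complex := Complex shift_cd_eq0 shift_cdd.
End Shift.

Section TwoTerm.
Variables (P1 P0 : lmodType R) (p : hom P1 P0).

(** [Negz 0] is the integer -1. *)
Definition two_term_obj (i : int) : lmodType R :=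
  match i with
  | Posz 0 => P0
  | Negz 0 => P1
  | _ => 'rV[R]_0
  end.

Definition two_term_d (i j : int) : hom (two_term_obj i) (two_term_obj j) :=
  match i, j return hom (two_term_obj i) (two_term_obj j) with
  | Negz 0, Posz 0 => p
  | _, _ => 0
  end.

Lemma two_term_d_eq0 i j : j != i + 1 -> two_term_d i j = 0.
Proof. by case: i j => [[|i]|[|i]] [[|j]|[|j]]. Qed.

Lemma two_term_dd i j k : homc (two_term_d j k) (two_term_d i j) = 0.
Proof.
by apply: homP; case: i j k => [[|i]|[|i]] [[|j]|[|j]] [[|k]|[|k]] x //=;
  rewrite raddf0.
Qed.

Definition two_term : complex := Complex two_term_d_eq0 two_term_dd.
End TwoTerm.

End Complexes.

Section Relative.
Variables (R : pzRingType) (X : fgmod R).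
Implicit Types (M N : fgmod R) (T : mclass R).

Definition hom_exact (Z A B C : lmodType R) (f : hom A B) (g : hom B C) :
    Prop :=
  short_exact (fun h : hom Z A => homc f h) (fun h : hom Z B => homc g h).

Definition F_exact (A B C : lmodType R) (f : hom A B) (g : hom B C) : Prop :=
  short_exact f g /\ forall Z : fgmod R, add X Z -> hom_exact Z f g.

Definition F_projective (P : fgmod R) : Prop :=
  forall (A B C : fgmod R) (f : hom A B) (g : hom B C),
    F_exact f g -> hom_exact P f g.

Definition genF M : mclass R :=
  fun Z => exists n (K : fgmod R) (f : hom K (power n M))
             (g : hom (power n M) Z), F_exact f g.

Definition F_torsion T : Prop :=
  (forall (A B C : fgmod R) (f : hom A B) (g : hom B C),
     F_exact f g -> T A -> T C -> T B) /\
  (forall (A B C : fgmod R) (f : hom A B) (g : hom B C),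
     F_exact f g -> T B -> T C).

Definition F_tor_preen : mclass R -> Prop :=
  fun T => [/\ exists2 M : fgmod R, T M & ~ is_zero M,
              preenveloping T & F_torsion T].

(** An F-projective resolution of [M], presented by its constituent short exact
    sequences [0 -> S_(n+1) -> P_n -> S_n -> 0], where [S_0 = M]. *)
Definition syz M (S : nat -> fgmod R) n : fgmod R :=
  if n is n'.+1 then S n' else M.

Record resolution M := Resolution {
  res_obj : nat -> fgmod R;
  res_syz : nat -> fgmod R;
  res_inc : forall n, hom (syz M res_syz n.+1) (res_obj n);
  res_cov : forall n, hom (res_obj n) (syz M res_syz n);
  res_proj : forall n, F_projective (res_obj n);
  res_exact : forall n, F_exact (res_inc n) (res_cov n) }.

(** [res_d r n] is the differential from [P_(n+1)] to [P_n], which is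
    [pi^(-n-1)] in cohomological indexing; [pi^0] is [res_cov r 0]. *)
Definition res_d M (r : resolution M) n : hom (res_obj r n.+1) (res_obj r n) :=
  homc (res_inc r n) (res_cov r n.+1).

Definition right_minimal (B C : lmodType R) (g : hom B C) : Prop :=
  forall h : hom B B, homc g h = g -> bijective h.

Record min_resolution M := MinResolution {
  min_res :> resolution M;
  min_resP : forall n, right_minimal (res_cov min_res n) }.

(** Vanishing of the first cohomology of [Hom(P, N)]. *)
Definition ext1F_eq0 M (r : resolution M) N : Prop :=
  forall h : hom (res_obj r 1) N, homc h (res_d r 1) = 0 ->
    exists h' : hom (res_obj r 0) N, h = homc h' (res_d r 0).

Section Presilting.
Variable res : forall M, min_resolution M.

Definition F_admissible : Prop :=
  forall M, ext1F_eq0 (res M) M ->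
    forall h : hom (res_obj (res M) 1) M, homc h (res_d (res M) 1) = 0.

Definition F_presilting M : Prop :=
  let P := two_term (res_d (res M) 0) in
  forall i : int, 0 < i -> homK_eq0 P (shift P i).

(** [hom X M] carries its structure of module over [(endo X)^c]. *)
Definition special_F_presilting M : Prop :=
  [/\ basic M, F_presilting M
    & exists P : lmodType (endo X)^c,
        is_PP (gen (hom X M : lmodType (endo X)^c)) P /\
        forall M' : fgmod R, ~ is_zero M' ->
          (forall Z : fgmod R, add M Z -> add M' Z -> is_zero Z) ->
          ~ direct_summand (hom X (M * M')%type : lmodType (endo X)^c) P].

Definition F_presilt_esp : mclass R -> Prop :=
  fun C => exists M : fgmod R,
    [/\ special_F_presilting M, preenveloping (genF M) & C = isoclass M].

End Presilting.
End Relative.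

(** [set_bij] from mathcomp-classical, without its universe bound on [S], [T]. *)
Definition bij_on (S T : Type) (A : S -> Prop) (B : T -> Prop) (f : S -> T) :
    Prop :=
  [/\ forall x, A x -> B (f x),
      forall x y, A x -> A y -> f x = f y -> x = y
    & forall y, B y -> exists2 x, A x & f x = y].

(* Main.v *)
From HB Require Import structures.
From mathcomp Require Import all_boot all_order all_algebra.
From mathcomp Require Import boolp classical_sets.
Require Import Defs.

(** Let [H = Hom(X, -)], a functor to the modules over [End(X)^op]. As [X] is a
    generator, [H] is full and faithful ([H_full], [H_faithful]). A sequence is
    F-exact when [H] makes it exact, [H] turns F-projectives into projectives,
    and [Z] is in [gen_F M] when [H Z] is in [gen (H M)] ([genF_gen]). Questions
    about the relative structure thus become questions about ordinary modules
    over [End(X)^op].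

    A module [M] with minimal resolution [P1 -> P0 -> M] is presilting exactly when
    every map [P1 -> M] extends to [P0] ([presilting_rigid]). The projective
    presentation [H P1 -> H P0 -> H M] then sees no extension of [H M] by a module
    of [gen (H M)] ([rigid_lift]), so that [M] is a relative Ext-projective of
    [gen_F M], and [gen_F M] is an F-torsion class ([genF_torsion]). By
    admissibility, vanishing of [Ext^1_F(M, M)] suffices for being presilting
    ([lifts_rigid]).

    The special modules are those that contain all the relative Ext-projectives.
    If [W] is a relative Ext-projective of [gen_F M], then [M + W] is again
    presilting, so that [H W] is Ext-projective in [gen (H M)] ([lifts_ext1]). If
    moreover [W] is indecomposable and not in [add M], then [H (M + W)] is a
    summand of [P(gen (H M))], which is what speciality excludes
    ([special_contains]). Hence a special [M] is the sum of all indecomposable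
    relative Ext-projectives of [gen_F M], and [gen_F M] determines it
    ([special_unique]).

    Conversely let [T] be a preenveloping F-torsion class, and let [X -> M0] be a
    minimal left approximation of [X] by a module of [T]. Wakamatsu's argument
    shows that [M0] is a relative Ext-projective of [T], and [T = gen_F M0] since
    [X] generates. The sum of all indecomposable relative Ext-projectives of [T] is
    special with the same [gen_F] ([torsion_class_special]). That there are only
    finitely many is seen over [End(X)^op]: if [e] is the element of [H M0] given
    by the approximation, the Ext-projectives of [gen (H M0)] are summands of
    powers of [H M0 + H M0 / <e>] ([ext_projective_bound]).

    All this rests on the Krull-Schmidt theorem for finitely generated modules over
    the algebra and over [End(X)^op]. Both rings are finite over the artinian ring
    [k], which is noetherian ([artinian_noetherian]), and this gives the chain
    conditions behind Fitting's lemma. *)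

Set Implicit Arguments.
Unset Strict Implicit.
Unset Printing Implicit Defensive.

Import Order.TTheory GRing.Theory Num.Theory.
Local Open Scope ring_scope.

(** * Chain conditions on ideals: artinian implies noetherian *)

(** Chain conditions are stated with sequences; they are mostly used through
    minimal elements, which dependent choice provides. *)
Lemma minimal_exists (T : Type) (D : T -> Prop) (lt : T -> T -> Prop) :
  (forall u : nat -> T, (forall n, D (u n)) -> ~ forall n, lt (u n.+1) (u n)) ->
  forall t, D t -> exists2 m, D m & forall s, D s -> ~ lt s m.
Proof.
move=> wf t Dt; apply: contrapT => nomin.
have step (m : {m | D m}) : {s : {m | D m} | lt (sval s) (sval m)}.
  apply: cid; apply: contrapT => nos; apply: nomin; exists (sval m); first exact: svalP m.
  by move=> s Ds sm; apply: nos; exists (exist _ s Ds).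
pose u := fun n => iter n (fun m => sval (step m)) (exist _ t Dt).
apply: (wf (fun n => sval (u n))) => n; first exact: svalP (u n).
exact: svalP (step (u n)).
Qed.

Definition desc (T : Type) (S : nat -> T -> Prop) : Prop := forall n x, S n.+1 x -> S n x.
Definition asc (T : Type) (S : nat -> T -> Prop) : Prop := forall n x, S n x -> S n.+1 x.
Definition stable (T : Type) (S : nat -> T -> Prop) : Prop :=
  exists n, forall m, (n <= m)%N -> forall x, S n x <-> S m x.

Lemma descP (T : Type) (S : nat -> T -> Prop) m n x :
  desc S -> (m <= n)%N -> S n x -> S m x.
Proof.
move=> dS /subnK <-; elim: (n - m)%N => [//|d IH]; rewrite addSn.
by move/dS.
Qed.

Lemma ascP (T : Type) (S : nat -> T -> Prop) m n x :
  asc S -> (m <= n)%N -> S m x -> S n x.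
Proof.
move=> dS /subnK <-; elim: (n - m)%N => [//|d IH]; rewrite addSn.
by move/IH/dS.
Qed.

Section Hopkins.
Variable k : comNzRingType.
Hypothesis artk : artinian k.
Implicit Types I J S : k -> Prop.

Definition noetherian_on S : Prop :=
  forall I : nat -> k -> Prop, (forall n, is_ideal (I n)) -> asc I ->
    (forall n x, I n x -> S x) -> stable I.

Lemma idealB I x y : is_ideal I -> I x -> I y -> I (x - y).
Proof. by case=> _ ID IM Ix Iy; apply: ID => //; rewrite -mulN1r; apply: IM. Qed.

Lemma min_ideal (D : (k -> Prop) -> Prop) I :
  (forall J, D J -> is_ideal J) -> D I ->
  exists2 J, D J & forall J', D J' -> (forall x, J' x -> J x) -> forall x, J x -> J' x.
Proof.
move=> Did DI.
case: (@minimal_exists _ D (fun J' J => (forall x, J' x -> J x) /\ exists2 x, J x & ~ J' x) _ I DI).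
- move=> u Du lt.
  case: (artk (fun n => Did _ (Du n)) (fun n => (lt n).1)) => n Hn.
  by case: (lt n) => _ [x ux []]; apply: Hn ux => //.
- move=> J DJ Jmin; exists J => // J' DJ' sub x Jx; apply: contrapT => nJ'x.
  by apply: (Jmin J' DJ'); split=> //; exists x.
Qed.

(** Multiplication by [a] makes [I] an extension of its image [a I] by its
    kernel. Working with these two ideals of [k] avoids quotient modules. *)
Lemma noetherian_mul I a : is_ideal I ->
  noetherian_on (fun y => exists2 x, I x & y = a * x) ->
  noetherian_on (fun x => I x /\ a * x = 0) -> noetherian_on I.
Proof.
move=> idI nim nker S idS ascS SI.
have [|||n1 H1] := nim (fun n y => exists2 x, S n x & y = a * x).
- move=> n; have [S0 SD SM] := idS n; split.
  + by exists 0; rewrite ?mulr0.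
  + by move=> _ _ [x Sx ->] [y Sy ->]; exists (x + y); rewrite ?mulrDr //; apply: SD.
  + by move=> b _ [x Sx ->]; exists (b * x); rewrite 1?mulrCA //; apply: SM.
- by move=> n _ [x Sx ->]; exists x => //; apply: ascS.
- by move=> n _ [x Sx ->]; exists x => //; apply: SI Sx.
have [|||n2 H2] := nker (fun n x => S n x /\ a * x = 0).
- move=> n; have [S0 SD SM] := idS n; split.
  + by rewrite mulr0.
  + by move=> x y [Sx ax] [Sy ay]; rewrite mulrDr ax ay addr0; split=> //; apply: SD.
  + by move=> b x [Sx ax]; rewrite mulrCA ax mulr0; split=> //; apply: SM.
- by move=> n x [Sx ax]; split=> //; apply: ascS.
- by move=> n x [Sx ax]; split=> //; apply: SI Sx.
exists (maxn n1 n2) => m; rewrite geq_max => /andP[l1 l2] x; split.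
  by apply: ascP => //; rewrite geq_max l1.
move=> Smx.
have [y Sy ay] : exists2 y, S n1 y & a * x = a * y.
  by apply/(H1 m l1); exists x.
have Smy : S m y by apply: ascP Sy.
have [Sxy _] : S n2 (x - y) /\ a * (x - y) = 0.
  apply/(H2 m l2); split; first exact: idealB.
  by rewrite mulrBr ay subrr.
rewrite -(subrK y x); have [_ SD _] := idS (maxn n1 n2).
apply: SD; first by apply: ascP Sxy => //; apply: leq_maxr.
by apply: ascP Sy => //; apply: leq_maxl.
Qed.

(** Zorn's lemma. In the proof of the next theorem [I] is a vector space over a
    residue field, and [J] is a hyperplane complementary to the line of [x0]. *)
Lemma ideal_avoiding I x0 : is_ideal I -> x0 <> 0 ->
  exists J, [/\ is_ideal J, forall x, J x -> I x, ~ J x0 &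
    forall J', is_ideal J' -> (forall x, J' x -> I x) -> ~ J' x0 ->
      (forall x, J x -> J' x) -> forall x, J' x -> J x].
Proof.
move=> idI x00.
pose P J := [/\ is_ideal J, forall x, J x -> I x & ~ J x0].
have P0 : P (fun x => x = 0).
  have [I0 _ _] := idI; split=> // [|x -> //].
  by split=> // [x y -> ->|a x ->]; rewrite ?addr0 ?mulr0.
pose T := {J : k -> Prop | P J}.
pose R (A B : T) := `[< forall x, sval A x -> sval B x >].
have [||||A Amax] := @Zorn T R.
- by move=> A; apply/asboolP.
- by move=> A B C /asboolP AB /asboolP BC; apply/asboolP => x /AB /BC.
- move=> [A PA] [B PB] /asboolP/= AB /asboolP/= BA; apply: eq_exist.
  by apply/predeqP => x; split; [apply: AB | apply: BA].
- move=> C totC.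
  have [[A0 CA0]|noC] := pselect (exists A, C A); last first.
    by exists (exist _ _ P0) => A CA; case: noC; exists A.
  pose U x := exists2 A : T, C A & sval A x.
  have PU : P U.
    split; last by case=> A _; case: (svalP A).
    - split.
      + by exists A0 => //; case: (svalP A0) => -[].
      + move=> x y [A CA Ax] [B CB By].
        have [/asboolP AB|/asboolP BA] := totC A B CA CB.
          by exists B => //; case: (svalP B) => -[_ BD _] _ _; apply: BD => //; apply: AB.
        by exists A => //; case: (svalP A) => -[_ AD _] _ _; apply: AD => //; apply: BA.
      + by move=> a x [A CA Ax]; exists A => //; case: (svalP A) => -[_ _ AM] _ _; apply: AM.
    - by move=> x [A CA]; case: (svalP A) => _ + _; apply.
  by exists (exist _ U PU) => A CA; apply/asboolP => x Ax; exists A.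
exists (sval A); have [idA AI Ax0] := svalP A; split=> // J' idJ' J'I J'x0 sub x J'x.
have PJ' : P J' by split.
by rewrite -(Amax (exist _ J' PJ')) //; apply/asboolP.
Qed.

(** Take an ideal [I] minimal among the non-noetherian ones. By minimality each
    scalar acts on [I] as zero or onto, so the annihilator of [I] is a prime
    ideal; the descending chain condition makes the quotient a field, over which
    [I] is a vector space. A hyperplane [J] of [I] is then noetherian, and [I]
    exceeds it by one dimension only. *)
Theorem artinian_noetherian : noetherian_on (fun _ => True).
Proof.
apply: contrapT => nonoeth.
case: (@min_ideal (fun I => is_ideal I /\ ~ noetherian_on I) (fun _ => True)).
- by move=> J [].
- by split=> //; split.
move=> I [idI nI] Imin.
have [I0 ID IM] := idI.
(* otherwise I is an extension of two ideals that are strictly smaller *)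
have zero_or_onto a : (forall x, I x -> a * x = 0) \/
    (forall x, I x -> exists2 y, I y & x = a * y).
  apply: contrapT => /not_orP[nz no]; apply: nI; apply: (@noetherian_mul I a) => //.
  - apply: contrapT => nn; apply: no; apply: Imin.
      split=> //; split.
      + by exists 0; rewrite ?mulr0.
      + by move=> _ _ [x Ix ->] [y Iy ->]; exists (x + y); rewrite ?mulrDr //; apply: ID.
      + by move=> b _ [x Ix ->]; exists (b * x); rewrite 1?mulrCA //; apply: IM.
    by move=> _ [x Ix ->]; apply: IM.
  - apply: contrapT => nn; apply: nz => x Ix.
    suff [] : I x /\ a * x = 0 by [].
    apply: (Imin (fun x => I x /\ a * x = 0)) => // [|y [] //]; split=> //; split.
    + by rewrite mulr0.
    + by move=> u v [Iu au] [Iv av]; rewrite mulrDr au av addr0; split=> //; apply: ID.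
    + by move=> b u [Iu au]; rewrite mulrCA au mulr0; split=> //; apply: IM.
have [x0 Ix0 x00] : exists2 x0, I x0 & x0 <> 0.
  apply: contrapT => nox; apply: nI => S idS _ SI; exists 0%N => m _ x.
  have z n y : S n y -> y = 0.
    by move=> Sy; apply: contrapT => y0; apply: nox; exists y => //; apply: SI Sy.
  split=> Sx; rewrite (z _ _ Sx).
    by case: (idS m).
  by case: (idS 0%N).
have [J [idJ JI Jx0 Jmax]] := ideal_avoiding idI x00.
have [J0 JD JM] := idJ.
have nJ : noetherian_on J.
  by apply: contrapT => nn; apply: Jx0; apply: (Imin J).
(* the chain of the ideals (c ^+ n) stops, which gives c an inverse modulo the
   annihilator of I *)
have inv c y : I y -> c * y <> 0 -> exists b, forall x, I x -> b * (c * x) = x.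
  move=> Iy cy.
  have onto : forall x, I x -> exists2 y, I y & x = c * y.
    by case: (zero_or_onto c) => // z; case: cy; apply: z.
  pose P n z := exists b, z = c ^+ n * b.
  have [n|n z [b ->]|n Hn] := artk (I := P).
  - split; first by exists 0; rewrite mulr0.
      by move=> _ _ [b ->] [b' ->]; exists (b + b'); rewrite mulrDr.
    by move=> a _ [b ->]; exists (a * b); rewrite mulrCA.
  - by exists (c * b); rewrite exprSr mulrA.
  have [b cb] : P n.+1 (c ^+ n) by apply: Hn => //; exists 1; rewrite mulr1.
  exists b => x Ix.
  have [x' Ix' ->] : exists2 x', I x' & x = c ^+ n * x'.
    elim: n {Hn cb b} x Ix => [|n IH] x Ix; first by exists x; rewrite ?mul1r.
    have [x1 Ix1 ->] := IH _ Ix; have [x2 Ix2 ->] := onto _ Ix1.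
    by exists x2; rewrite // exprSr mulrA.
  by rewrite [in RHS]cb exprSr !mulrA; congr (_ * _); rewrite [in LHS]mulrC mulrA mulrAC.
(* I = J + k x0, and J is maximal without x0, so I = J + S as soon as S is not
   inside J *)
have big S : is_ideal S -> (forall x, S x -> I x) -> forall y, S y -> ~ J y ->
    forall x, I x -> exists2 s, S s & J (x - s).
  move=> [S0 SD SM] SI y Sy Jy.
  have hit z : I z -> ~ J z -> exists c, J (x0 - c * z).
    move=> Iz Jz; apply: contrapT => no.
    have idJz : is_ideal (fun x => exists c, J (x - c * z)).
      split.
      - by exists 0; rewrite mul0r subr0.
      - move=> u v [c Jc] [d Jd]; exists (c + d).
        by rewrite mulrDl opprD addrACA; apply: JD.
      - by move=> a u [c Jc]; exists (a * c); rewrite -mulrA -mulrBr; apply: JM.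
    apply: Jz; apply: (Jmax _ idJz).
    - move=> x [c /JI Ixc]; rewrite -(subrK (c * z) x); apply: ID => //; exact: IM.
    - by case=> c Jc; apply: no; exists c.
    - by move=> x Jx; exists 0; rewrite mul0r subr0.
    - by exists 1; rewrite mul1r subrr.
  have key z : I z -> exists a, J (z - a * x0).
    move=> Iz; have [Jz|Jz] := pselect (J z); first by exists 0; rewrite mul0r subr0.
    have [c Jc] := hit z Iz Jz.
    have cz : c * z <> 0 by move=> cz; apply: Jx0; move: Jc; rewrite cz subr0.
    have [b Hb] := inv c z Iz cz.
    exists b; rewrite -[X in X - _](Hb z Iz) -mulrBr; apply: (JM).
    by rewrite -opprB -mulN1r; apply: JM.
  have [c Jc] := hit y (SI _ Sy) Jy.
  move=> x Ix; have [a Ja] := key x Ix.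
  exists (a * (c * y)); first by apply: (SM); apply: SM.
  rewrite -(subrK (a * x0) x) -addrA -mulrBr; apply: (JD) => //; exact: JM.
apply: nI => S idS ascS SI.
have [[n0 [y Sy Jy]]|allJ] := pselect (exists n0, exists2 y, S n0 y & ~ J y); last first.
  apply: nJ => // n x Sx; apply: contrapT => Jx; apply: allJ; exists n; by exists x.
have [|||n1 H1] := nJ (fun n x => S n x /\ J x).
- move=> n; have [S0 SD SM] := idS n; split=> // [u v [Su Ju] [Sv Jv]|a u [Su Ju]].
    by split; [apply: SD | apply: JD].
  by split; [apply: SM | apply: JM].
- by move=> n x [Sx Jx]; split=> //; apply: ascS.
- by move=> n x [].
exists (maxn n0 n1) => m; rewrite geq_max => /andP[l0 l1] x; split.
  by apply: ascP => //; rewrite geq_max l0.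
move=> Smx.
have [s Ss Js] := big (S n0) (idS n0) (SI n0) y Sy Jy x (SI _ _ Smx).
have [Sxs _] : S n1 (x - s) /\ J (x - s).
  by apply/(H1 m l1); split=> //; apply: idealB => //; apply: ascP Ss.
rewrite -(subrK s x); have [_ SD _] := idS (maxn n0 n1).
by apply: SD; [apply: ascP Sxs | apply: ascP Ss]; rewrite // ?leq_maxl ?leq_maxr.
Qed.

End Hopkins.

(** * Linear maps, submodules, quotients and direct sums *)

Section Homs.
Variable R : pzRingType.
Implicit Types U V W : lmodType R.

Definition linhom U V (f : U -> V) (lf : linear f) : hom U V :=
  HB.pack f (GRing.isLinear.Build R U V *:%R f lf).

Lemma linhomE U V (f : U -> V) (lf : linear f) x : linhom lf x = f x.
Proof. by []. Qed.

Lemma homcE U V W (f : hom V W) (g : hom U V) x : homc f g x = f (g x).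
Proof. by []. Qed.
Lemma hom1E U x : hom1 U x = x.
Proof. by []. Qed.
Lemma hom0E U V x : (0 : hom U V) x = 0.
Proof. by []. Qed.
Lemma homDE U V (f g : hom U V) x : (f + g) x = f x + g x.
Proof. by []. Qed.
Lemma homBE U V (f g : hom U V) x : (f - g) x = f x - g x.
Proof. by []. Qed.
Lemma hom_sumE U V I (r : seq I) (P : pred I) (f : I -> hom U V) x :
  (\sum_(i <- r | P i) f i) x = \sum_(i <- r | P i) f i x.
Proof. by apply: (big_morph (fun h : hom U V => h x)) => [f' g'|]. Qed.

Lemma hom_0 U V (f : hom U V) : f 0 = 0. Proof. exact: raddf0. Qed.
Lemma hom_D U V (f : hom U V) x y : f (x + y) = f x + f y. Proof. exact: raddfD. Qed.
Lemma hom_N U V (f : hom U V) x : f (- x) = - f x. Proof. exact: raddfN. Qed.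
Lemma hom_B U V (f : hom U V) x y : f (x - y) = f x - f y. Proof. exact: raddfB. Qed.
Lemma hom_Z U V (f : hom U V) a x : f (a *: x) = a *: f x. Proof. exact: linearZ. Qed.
Lemma hom_P U V (f : hom U V) a x y : f (a *: x + y) = a *: f x + f y.
Proof. exact: linearP. Qed.
Lemma hom_sum U V (f : hom U V) I (r : seq I) (P : pred I) (x : I -> U) :
  f (\sum_(i <- r | P i) x i) = \sum_(i <- r | P i) f (x i).
Proof. exact: raddf_sum. Qed.

Lemma homc0 U V W (f : hom V W) : homc f (0 : hom U V) = 0.
Proof. by apply: homP => x; rewrite homcE !hom0E hom_0. Qed.
Lemma hom0c U V W (g : hom U V) : homc (0 : hom V W) g = 0.
Proof. exact: homP. Qed.
Lemma homcBl U V W (f g : hom V W) (h : hom U V) :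
  homc (f - g) h = homc f h - homc g h.
Proof. exact: homP. Qed.
Lemma homcBr U V W (f : hom V W) (g h : hom U V) :
  homc f (g - h) = homc f g - homc f h.
Proof. by apply: homP => x; rewrite homcE !homBE hom_B. Qed.
Lemma homc_suml U V W I (r : seq I) (P : pred I) (f : I -> hom V W) (g : hom U V) :
  homc (\sum_(i <- r | P i) f i) g = \sum_(i <- r | P i) homc (f i) g.
Proof. by apply: homP => x; rewrite homcE !hom_sumE. Qed.
Lemma homc_sumr U V W I (r : seq I) (P : pred I) (f : hom V W) (g : I -> hom U V) :
  homc f (\sum_(i <- r | P i) g i) = \sum_(i <- r | P i) homc f (g i).
Proof. by apply: homP => x; rewrite homcE !hom_sumE hom_sum. Qed.

(** Maps induced on quotients, into subobjects, or by inverting a bijection are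
    all given by functional linear relations. *)
Lemma hom_of_rel U V (r : U -> V -> Prop) :
  (forall x, exists y, r x y) -> (forall y, r 0 y -> y = 0) ->
  (forall a x y x' y', r x y -> r x' y' -> r (a *: x + x') (a *: y + y')) ->
  exists h : hom U V, forall x, r x (h x).
Proof.
move=> tot fun0 lin; pose f x := xget 0 (r x).
have rf x : r x (f x) by rewrite /f; case: xgetP => // nr; case: (tot x) => y /nr.
have uniq x y y' : r x y -> r x y' -> y = y'.
  move=> rxy rxy'; apply/esym/eqP; rewrite -subr_eq0 addrC -scaleN1r; apply/eqP.
  by apply: fun0; rewrite -(addNr x) -scaleN1r; apply: lin.
have lf : linear f by move=> a x y; apply: uniq (rf _) _; apply: lin; apply: rf.
by exists (linhom lf).
Qed.

Lemma factor_epi U V W (p : hom U V) (h : hom U W) :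
  (forall y, exists x, p x = y) -> (forall x, p x = 0 -> h x = 0) ->
  exists h' : hom V W, homc h' p = h.
Proof.
move=> surj ker.
have [|z|a x y x' y'|h' Hh] :=
  @hom_of_rel V W (fun y z => exists x, p x = y /\ h x = z).
- by move=> y; have [x <-] := surj y; exists (h x), x.
- by case=> x [/ker -> <-].
- by case=> u [<- <-] [v [<- <-]]; exists (a *: u + v); rewrite !hom_P.
exists h'; apply: homP => x; rewrite homcE; have [x' [px <-]] := Hh (p x).
have := ker (x' - x); rewrite !hom_B px subrr => /(_ erefl)/eqP.
by rewrite subr_eq0 => /eqP.
Qed.

Lemma factor_mono U V W (i : hom V W) (h : hom U W) :
  injective i -> (forall x, exists y, i y = h x) ->
  exists h' : hom U V, homc i h' = h.
Proof.
move=> inj im.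
have [|y|a x y x' y' iy iy'|h' Hh] := @hom_of_rel U V (fun x y => i y = h x).
- exact: im.
- by rewrite hom_0 => i0; apply: inj; rewrite i0 hom_0.
- by rewrite !hom_P iy iy'.
by exists h'; apply: homP => x; rewrite homcE.
Qed.

Lemma bij_inverse U V (f : hom U V) : bijective f ->
  exists g : hom V U, homc g f = hom1 U /\ homc f g = hom1 V.
Proof.
case=> g0 fK gK.
have [|||g Hg] := @hom_of_rel V U (fun y x => f x = y).
- by move=> y; exists (g0 y).
- by move=> x fx; rewrite -(fK x) fx -(hom_0 f) fK.
- by move=> a x y x' y' <- <-; rewrite hom_P.
exists g; split; apply: homP => x; last by rewrite homcE Hg.
by rewrite homcE -(fK (g (f x))) Hg fK.
Qed.

Lemma inverse_bij U V (f : hom U V) (g : hom V U) :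
  homc g f = hom1 U -> homc f g = hom1 V -> bijective f.
Proof.
move=> gf fg; exists g => x.
  by rewrite -[RHS](hom1E x) -gf.
by rewrite -[RHS](hom1E x) -fg.
Qed.

Lemma inj_surj_bij U V (f : hom U V) :
  (forall x, f x = 0 -> x = 0) -> (forall y, exists x, f x = y) -> bijective f.
Proof.
move=> inj surj.
have injf : injective f.
  by move=> x y e; apply/eqP; rewrite -subr_eq0; apply/eqP/inj; rewrite hom_B e subrr.
have [|g fg] := @factor_mono V U V f (hom1 V) injf; first by move=> y; apply: surj.
exists g => x; last by rewrite -[RHS](hom1E x) -fg.
by apply: injf; rewrite -[RHS](hom1E (f x)) -fg.
Qed.

Definition submod (M : lmodType R) (S : M -> Prop) : Prop :=
  S 0 /\ forall a x y, S x -> S y -> S (a *: x + y).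

End Homs.

Section Sub.
Variables (R : pzRingType) (M : lmodType R) (S : M -> Prop) (subS : submod S).

(** The proof that [S] is a submodule is an argument of the type, so that the
    module structure, which depends on it, can be inferred from the type. *)
Definition sub_carrier (_ : submod S) := {x : M | `[< S x >]}.
Local Notation K := (sub_carrier subS).
HB.instance Definition _ := [isSub of K for (@sval M (fun x => `[< S x >]) : K -> M)].
HB.instance Definition _ := [Choice of K by <:].

Lemma sub_closed a x y : S x -> S y -> S (a *: x + y).
Proof. exact: (subS.2). Qed.
Lemma subP (u : K) : S (\val u). Proof. exact/asboolP/(valP u). Qed.
Definition mksub x (Sx : S x) : K := Sub x (asboolT Sx).

Lemma sub0P : S 0. Proof. exact: subS.1. Qed.
Lemma subZP a (u : K) : S (a *: val u).
Proof. by rewrite -[_ *: _]addr0; apply: sub_closed (subP u) sub0P. Qed.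
Lemma subDP (u v : K) : S (val u + val v).
Proof. by rewrite -[val u]scale1r; apply: sub_closed; apply: subP. Qed.
Lemma subNP (u : K) : S (- val u).
Proof. by rewrite -scaleN1r; apply: subZP. Qed.

Let zero : K := mksub sub0P.
Let opp u : K := mksub (subNP u).
Let plus u v : K := mksub (subDP u v).
Let scl a u : K := mksub (subZP a u).

Let plusA : associative plus. Proof. by move=> u v w; apply: val_inj; rewrite /= addrA. Qed.
Let plusC : commutative plus. Proof. by move=> u v; apply: val_inj; rewrite /= addrC. Qed.
Let plus0 : left_id zero plus. Proof. by move=> u; apply: val_inj; rewrite /= add0r. Qed.
Let plusN : left_inverse zero opp plus.
Proof. by move=> u; apply: val_inj; rewrite /= addNr. Qed.
HB.instance Definition _ := GRing.isZmodule.Build K plusA plusC plus0 plusN.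

Let sclA a b u : scl a (scl b u) = scl (a * b) u.
Proof. by apply: val_inj; rewrite /= scalerA. Qed.
Let scl1 : left_id 1 scl. Proof. by move=> u; apply: val_inj; rewrite /= scale1r. Qed.
Let sclDr : right_distributive scl +%R.
Proof. by move=> a u v; apply: val_inj; rewrite /= scalerDr. Qed.
Let sclDl u : {morph scl^~ u : a b / a + b}.
Proof. by move=> a b; apply: val_inj; rewrite /= scalerDl. Qed.
HB.instance Definition _ := GRing.Zmodule_isLmodule.Build R K sclA scl1 sclDr sclDl.

Lemma sub_exists : exists (A : lmodType R) (i : hom A M),
  injective i /\ forall x, S x <-> exists y, i y = x.
Proof.
have lv : linear (val : K -> M) by [].
exists K, (linhom lv); split=> [|x]; first exact: val_inj.
split=> [Sx|[y <-]]; last exact: subP.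
by exists (mksub Sx).
Qed.

End Sub.

Section Quotient.
Variables (R : pzRingType) (M : lmodType R) (S : M -> Prop) (subS : submod S).

(** A coset is encoded by a chosen representative; that the choice depends only
    on the coset is [repr_eq] below. *)
Definition coset_repr (x : M) : M := xget 0 (fun y => S (y - x)).

Let S0 : S 0. Proof. exact: subS.1. Qed.
Let SP a x y : S x -> S y -> S (a *: x + y). Proof. exact: subS.2. Qed.
Let SD x y : S x -> S y -> S (x + y).
Proof. by move=> Sx Sy; rewrite -[x]scale1r; apply: SP. Qed.
Let SN x : S x -> S (- x).
Proof. by move=> Sx; rewrite -scaleN1r -[_ *: _]addr0; apply: SP. Qed.

Let reprP x : S (coset_repr x - x).
Proof. by rewrite /coset_repr; case: xgetP => [y _ //|/(_ x)[]]; rewrite subrr. Qed.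

Let repr_eq x y : S (x - y) -> coset_repr x = coset_repr y.
Proof.
move=> Sxy; congr (xget 0 _); apply/predeqP => z; split=> Sz.
  by rewrite -(subrKA x); apply: SD.
by rewrite -(subrKA y); apply: SD => //; rewrite -opprB; apply: SN.
Qed.

Let repr_S x y : coset_repr x = coset_repr y -> S (x - y).
Proof.
move=> e; rewrite -(subrKA (coset_repr x)) {2}e; apply: SD; last exact: reprP.
by rewrite -opprB; apply/SN/reprP.
Qed.

Let repr_idem x : coset_repr (coset_repr x) = coset_repr x.
Proof. exact/repr_eq/reprP. Qed.

Definition quot_carrier (_ : submod S) := {x : M | coset_repr x == x}.
Local Notation Q := (quot_carrier subS).
HB.instance Definition _ := [isSub of Q for (@sval M (fun x => coset_repr x == x) : Q -> M)].
HB.instance Definition _ := [Choice of Q by <:].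

Definition coset_of x : Q := exist _ (coset_repr x) (introT eqP (repr_idem x)).
Let valK (u : Q) : coset_of (val u) = u.
Proof. by apply: val_inj; exact/eqP/(valP u). Qed.
Let coset_eq x y : S (x - y) -> coset_of x = coset_of y.
Proof. by move=> Sxy; apply: val_inj; apply: repr_eq. Qed.
Let val_coset x : S (val (coset_of x) - x). Proof. exact: reprP. Qed.

Let plus (u v : Q) : Q := coset_of (val u + val v).
Let opp (u : Q) : Q := coset_of (- val u).
Let scl a (u : Q) : Q := coset_of (a *: val u).

Let plusE x y : plus (coset_of x) (coset_of y) = coset_of (x + y).
Proof. by apply: coset_eq; rewrite opprD addrACA; apply: SD; apply: val_coset. Qed.
Let sclE a x : scl a (coset_of x) = coset_of (a *: x).
Proof.
by apply: coset_eq; rewrite -scalerBr -[_ *: _]addr0; apply: SP => //; apply: val_coset.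
Qed.
Let oppE x : opp (coset_of x) = coset_of (- x).
Proof. by apply: coset_eq; rewrite -opprD; apply: SN; apply: val_coset. Qed.

Let plusA : associative plus.
Proof. by move=> u v w; rewrite -(valK u) -(valK v) -(valK w) !plusE addrA. Qed.
Let plusC : commutative plus.
Proof. by move=> u v; rewrite -(valK u) -(valK v) !plusE addrC. Qed.
Let plus0 : left_id (coset_of 0) plus.
Proof. by move=> u; rewrite -(valK u) !plusE add0r. Qed.
Let plusN : left_inverse (coset_of 0) opp plus.
Proof. by move=> u; rewrite -(valK u) oppE !plusE addNr. Qed.
HB.instance Definition _ := GRing.isZmodule.Build Q plusA plusC plus0 plusN.

Let addE (u v : Q) : u + v = plus u v. Proof. by []. Qed.
Let sclA a b u : scl a (scl b u) = scl (a * b) u.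
Proof. by rewrite -(valK u) !sclE scalerA. Qed.
Let scl1 : left_id 1 scl.
Proof. by move=> u; rewrite -(valK u) !sclE scale1r. Qed.
Let sclDr : right_distributive scl +%R.
Proof.
by move=> a u v; rewrite -(valK u) -(valK v) addE plusE [LHS]sclE addE !sclE plusE scalerDr.
Qed.
Let sclDl u : {morph scl^~ u : a b / a + b}.
Proof. by move=> a b; rewrite -(valK u) addE !sclE plusE scalerDl. Qed.
HB.instance Definition _ := GRing.Zmodule_isLmodule.Build R Q sclA scl1 sclDr sclDl.

Lemma quot_exists : exists (A : lmodType R) (p : hom M A),
  (forall y, exists x, p x = y) /\ forall x, p x = 0 <-> S x.
Proof.
have lc : linear coset_of.
  by move=> a x y; rewrite -plusE -sclE.
exists Q, (linhom lc); split=> [u|x]; first by exists (val u); apply: valK.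
split=> [e|Sx]; last by apply: coset_eq; rewrite subr0.
by rewrite -[x]subr0; apply: repr_S; apply: (congr1 val e).
Qed.

End Quotient.

Section Sums.
Variable R : pzRingType.

Section Dsum.
Variables (n : nat) (M : 'I_n -> lmodType R).

Lemma proj_linear i : linear (fun f : dsum M => f i).
Proof. by move=> a f g; rewrite !ffunE. Qed.
Definition proj i : hom (dsum M) (M i) := linhom (proj_linear i).

Lemma incl_linear i :
  linear (fun x : M i => [ffun j => dfwith (fun j : 'I_n => 0 : M j) x j] : dsum M).
Proof.
move=> a x y; apply/ffunP => j; rewrite !ffunE.
have [<-|ij] := eqVneq i j; first by rewrite !dfwith_in.
by rewrite !dfwith_out // scaler0 addr0.
Qed.
Definition incl i : hom (M i) (dsum M) := linhom (@incl_linear i).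

Lemma proj_incl i : homc (proj i) (incl i) = hom1 (M i).
Proof. by apply: homP => x; rewrite homcE linhomE linhomE ffunE dfwith_in. Qed.

Lemma proj_incl_neq i j : i != j -> homc (proj j) (incl i) = 0.
Proof. by move=> ij; apply: homP => x; rewrite homcE linhomE linhomE ffunE dfwith_out. Qed.

Lemma sum_incl_proj : \sum_i homc (incl i) (proj i) = hom1 (dsum M).
Proof.
apply: homP => f; apply/ffunP => j; rewrite hom_sumE hom1E.
have -> : (\sum_i homc (incl i) (proj i) f) j = \sum_i proj j (homc (incl i) (proj i) f).
  exact: (hom_sum (proj j)).
have E i : proj j (homc (incl i) (proj i) f) = if i == j then f j else 0.
  have [->|ij] := eqVneq i j.
    exact: (congr1 (fun h : hom _ _ => h (proj j f)) (proj_incl j)).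
  exact: (congr1 (fun h : hom _ _ => h (proj i f)) (proj_incl_neq ij)).
by rewrite (eq_bigr _ (fun i _ => E i)) -big_mkcond big_pred1_eq.
Qed.
End Dsum.

Section Pair.
Variables U V : lmodType R.
Lemma fst_linear : linear (fun x : (U * V)%type => x.1). Proof. by []. Qed.
Lemma snd_linear : linear (fun x : (U * V)%type => x.2). Proof. by []. Qed.
Lemma inl_linear : linear (fun x : U => (x, 0) : (U * V)%type).
Proof. by move=> a x y; congr pair => //=; rewrite scaler0 addr0. Qed.
Lemma inr_linear : linear (fun x : V => (0, x) : (U * V)%type).
Proof. by move=> a x y; congr pair => //=; rewrite scaler0 addr0. Qed.
Definition pfst : hom (U * V)%type U := linhom fst_linear.
Definition psnd : hom (U * V)%type V := linhom snd_linear.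
Definition pinl : hom U (U * V)%type := linhom inl_linear.
Definition pinr : hom V (U * V)%type := linhom inr_linear.

Lemma pfst_inl : homc pfst pinl = hom1 U. Proof. exact: homP. Qed.
Lemma psnd_inr : homc psnd pinr = hom1 V. Proof. exact: homP. Qed.
Lemma pfst_inr : homc pfst pinr = 0. Proof. exact: homP. Qed.
Lemma psnd_inl : homc psnd pinl = 0. Proof. exact: homP. Qed.
Lemma sum_pair : homc pinl pfst + homc pinr psnd = hom1 (U * V)%type.
Proof.
by apply: homP => -[x y]; congr pair => /=; rewrite ?addr0 ?add0r.
Qed.
End Pair.
End Sums.

(** * Modules over a ring that is finite over an artinian ring *)

Section Span.
Variables (k R : pzRingType) (phi : k -> R).

(** The modules below are over [R], but sizes are measured over [k]. For [phi]
    the identity these are the notions over [R] itself. *)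
Record scalar_map : Prop := ScalarMap {
  scalar_D : forall a b, phi (a + b) = phi a + phi b;
  scalar_M : forall a b, phi (a * b) = phi a * phi b;
  scalar_1 : phi 1 = 1 }.

Hypothesis phiP : scalar_map.

Lemma scalar_0 : phi 0 = 0.
Proof. by apply: (addIr (phi 0)); rewrite -scalar_D // !add0r. Qed.
Lemma scalar_N a : phi (- a) = - phi a.
Proof. by apply: (addIr (phi a)); rewrite -scalar_D // !addNr scalar_0. Qed.

Definition ksub (M : lmodType R) (S : M -> Prop) : Prop :=
  [/\ S 0, forall x y, S x -> S y -> S (x + y) & forall a x, S x -> S (phi a *: x)].

(** Subtracting the multiples of the generators one at a time, instead of
    summing over an index type, lets every proof go by induction on [s]. *)
Fixpoint span (M : lmodType R) (s : seq M) (x : M) : Prop :=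
  if s is y :: s' then exists a, span s' (x - phi a *: y) else x = 0.

Variable M : lmodType R.
Implicit Types (S : M -> Prop) (s : seq M) (x y : M).

Lemma ksub_sum S I (r : seq I) (P : pred I) (f : I -> M) :
  ksub S -> (forall i, P i -> S (f i)) -> S (\sum_(i <- r | P i) f i).
Proof. by case=> S0 SD _ Sf; elim/big_ind: _. Qed.

Lemma ksubB S x y : ksub S -> S x -> S y -> S (x - y).
Proof.
case=> _ SD SZ Sx Sy; apply: SD => //.
by rewrite -scaleN1r -(scalar_1 phiP) -scalar_N; apply: SZ.
Qed.

Lemma span_ksub s : ksub (span s).
Proof.
elim: s => [|y s [S0 SD SZ]] /=.
  by split=> [//|x z -> ->|a x ->]; rewrite ?addr0 ?scaler0.
split.
- by exists 0; rewrite scalar_0 scale0r subr0.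
- move=> x z [a Ha] [b Hb]; exists (a + b).
  by rewrite scalar_D // scalerDl opprD addrACA; apply: SD.
- move=> a x [b Hb]; exists (a * b).
  by rewrite scalar_M // -scalerA -scalerBr; apply: SZ.
Qed.

Lemma span_min s S : ksub S -> (forall y, y \in s -> S y) -> forall x, span s x -> S x.
Proof.
move=> kS; have [S0 SD SZ] := kS.
elim: s => [|y s IH] Ss x /=; first by move->.
case=> a Ha; rewrite -(subrK (phi a *: y) x); apply: SD.
  by apply: IH => // z sz; apply: Ss; rewrite in_cons sz orbT.
by apply/SZ/Ss; rewrite mem_head.
Qed.

Lemma span_cons s y x : span s x -> span (y :: s) x.
Proof. by move=> sx; exists 0; rewrite scalar_0 scale0r subr0. Qed.

Lemma span_mem s y : y \in s -> span s y.
Proof.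
elim: s => [//|z s IH]; rewrite in_cons => /orP[/eqP->|/IH]; last exact: span_cons.
by exists 1; rewrite scalar_1 // scale1r subrr; have [] := span_ksub s.
Qed.

Lemma span_sub s t : (forall y, y \in s -> span t y) -> forall x, span s x -> span t x.
Proof. by apply: span_min; apply: span_ksub. Qed.

Lemma span_sum s x : span s x ->
  exists a : nat -> k, x = \sum_(i < size s) phi (a i) *: s`_i.
Proof.
elim: s x => [|y s IH] x /=; first by move->; exists (fun _ => 0); rewrite big_ord0.
case=> a /IH[b Hb]; exists (fun i => if i is i'.+1 then b i' else a).
by rewrite big_ord_recl /= -Hb addrCA subrr addr0.
Qed.

End Span.

Lemma ksub_hom (k R : pzRingType) (phi : k -> R) (U V : lmodType R) (f : hom U V)
  (S : V -> Prop) : ksub phi S -> ksub phi (fun x => S (f x)).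
Proof.
case=> S0 SD SZ; split=> [|x y Sx Sy|a x Sx]; rewrite ?hom_0 ?hom_D ?hom_Z //.
  exact: SD.
exact: SZ.
Qed.

Lemma id_scalar (R : pzRingType) : scalar_map (@id R).
Proof. by []. Qed.

Section FinGen.
Variable R : pzRingType.
Implicit Types U V M : lmodType R.

Lemma ksub_submod M (S : M -> Prop) : ksub id S <-> submod S.
Proof.
split=> [[S0 SD SZ]|[S0 SP]]; first by split=> // a x y Sx Sy; apply: SD => //; apply: SZ.
split=> // [x y Sx Sy|a x Sx]; first by rewrite -[x]scale1r; apply: SP.
by rewrite -[_ *: _]addr0; apply: SP.
Qed.

Lemma fg_span M :
  finitely_generated M <-> exists s : seq M, forall x, span id s x.
Proof.
split=> [[n [g Hg]]|[s Hs]].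
  exists (codom g) => x; have [a ->] := Hg x.
  apply: ksub_sum => [|i _]; first exact/span_ksub/id_scalar.
  have [_ _] := span_ksub (id_scalar R) (codom g); apply.
  by apply: span_mem; [apply: id_scalar|apply: codom_f].
exists (size s), (fun i : 'I_(size s) => s`_i) => x.
by have [a ->] := span_sum (Hs x); exists (fun i => a i).
Qed.

Lemma span_map U V (f : hom U V) s x : span id s x -> span id (map f s) (f x).
Proof.
apply: (@span_min R R id U s (fun x => span id (map f s) (f x))).
  exact/ksub_hom/span_ksub/id_scalar.
by move=> y sy; apply: span_mem; [apply: id_scalar|apply: map_f].
Qed.

Lemma fg_surj U V (f : hom U V) : (forall y, exists x, f x = y) ->
  finitely_generated U -> finitely_generated V.
Proof.
move=> surj /fg_span[s Hs]; apply/fg_span; exists (map f s) => y.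
by have [x <-] := surj y; apply: span_map.
Qed.

Lemma fg_dsum n (M : 'I_n -> lmodType R) :
  (forall i, finitely_generated (M i)) -> finitely_generated (dsum M).
Proof.
move=> fgM; apply/fg_span.
have fgM' i : {s : seq (M i) | forall x, span id s x} by apply/cid/fg_span.
exists (flatten [seq [seq incl M i y | y <- sval (fgM' i)] | i : 'I_n]) => x.
rewrite -[x](hom1E x) -sum_incl_proj hom_sumE.
apply: ksub_sum => [|i _]; first exact/span_ksub/id_scalar.
apply: span_sub (span_map (incl M i) (svalP (fgM' i) (proj M i x))); first exact: id_scalar.
move=> y my; apply: span_mem; first exact: id_scalar.
by apply/flatten_mapP; exists i => //; rewrite mem_enum.
Qed.

Lemma fg_pair U V : finitely_generated U -> finitely_generated V ->
  finitely_generated (U * V)%type.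
Proof.
move=> /fg_span[s Hs] /fg_span[t Ht]; apply/fg_span.
exists (map (pinl U V) s ++ map (pinr U V) t) => x.
have [_ SD _] := span_ksub (id_scalar R) (map (pinl U V) s ++ map (pinr U V) t).
rewrite -[x](hom1E x) -sum_pair homDE; apply: SD.
  apply: span_sub (span_map (pinl U V) (Hs x.1)); first exact: id_scalar.
  by move=> y my; apply: span_mem; [apply: id_scalar|rewrite mem_cat my].
apply: span_sub (span_map (pinr U V) (Ht x.2)); first exact: id_scalar.
by move=> y my; apply: span_mem; [apply: id_scalar|rewrite mem_cat my orbT].
Qed.

End FinGen.

Definition monotone (T : Type) (S : nat -> T -> Prop) : Prop := asc S \/ desc S.

Lemma monotone_cmp T (S : nat -> T -> Prop) m n : monotone S ->
  (forall x, S m x -> S n x) \/ (forall x, S n x -> S m x).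
Proof.
wlog mn : m n / (m <= n)%N.
  move=> W monoS; have [/W|/ltnW/W] := leqP m n; first exact.
  by case/(_ monoS); [right|left].
by case=> [a|d]; [left => x; apply: ascP|right => x; apply: descP].
Qed.

Definition chain_fin (R : pzRingType) (M : lmodType R) : Prop :=
  forall T : nat -> M -> Prop, (forall n, submod (T n)) -> monotone T -> stable T.

Section ArtinBase.
Variables (k : comNzRingType) (R : pzRingType) (phi : k -> R).
Hypotheses (artk : artinian k) (phiP : scalar_map phi).
Hypothesis central : forall a r, phi a * r = r * phi a.

Lemma ideals_stable (I : nat -> k -> Prop) :
  (forall n, is_ideal (I n)) -> monotone I -> stable I.
Proof.
move=> idI [ascI|descI]; first exact: artinian_noetherian.
have [n Hn] := artk idI descI; exists n => m nm x.
by split; [apply: Hn | apply: descP].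
Qed.

(** Induction on the number of generators: a submodule of [span (g :: s)] is
    determined, among the submodules comparable to it, by its part inside
    [span s] and by the ideal of the coefficients of [g] in its elements. Both
    chains stop, the second one because [k] is artinian and noetherian. *)
Lemma span_stable (M : lmodType R) (s : seq M) (T : nat -> M -> Prop) :
  (forall n, ksub phi (T n)) -> monotone T -> (forall n x, T n x -> span phi s x) ->
  stable T.
Proof.
elim: s T => [|g s IH] T kT monoT sT.
  exists 0%N => m _ x; split=> /[dup] Tx /sT ->; first by have [] := kT m.
  by have [] := kT 0%N.
have kS := span_ksub phiP s; have [S0 SD SZ] := kS.
have [|||n1 H1] := IH (fun n x => T n x /\ span phi s x).
- move=> n; have [T0 TD TZ] := kT n; split=> // [x y [Tx Sx] [Ty Sy]|a x [Tx Sx]].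
    by split; [apply: TD|apply: SD].
  by split; [apply: TZ|apply: SZ].
- by case: monoT => H; [left|right] => n x [/H].
- by move=> n x [].
have [||n2 H2] := @ideals_stable (fun n a => exists2 x, span phi s x & T n (x + phi a *: g)).
- move=> n; have [T0 TD TZ] := kT n; split.
  + by exists 0; rewrite // scalar_0 // scale0r addr0.
  + move=> a b [x Sx Tx] [y Sy Ty]; exists (x + y); first exact: SD.
    by rewrite scalar_D // scalerDl addrACA; apply: TD.
  + move=> a b [x Sx Tx]; exists (phi a *: x); first exact: SZ.
    by rewrite scalar_M // -scalerA -scalerDr; apply: TZ.
- by case: monoT => H; [left|right] => n a [x Sx /H]; exists x.
have key m n : (n1 <= m)%N -> (n2 <= m)%N -> (n1 <= n)%N -> (n2 <= n)%N ->
    (forall x, T m x -> T n x) -> forall x, T n x -> T m x.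
  move=> m1 m2 n1' n2' mn x Tx; have [a Sx] := sT _ _ Tx.
  have [_ TmD _] := kT m; have [_ TnD _] := kT n.
  have : exists2 y, span phi s y & T n2 (y + phi a *: g).
    by apply/(H2 n n2'); exists (x - phi a *: g); rewrite ?subrK.
  case/(H2 m m2) => y Sy Ty.
  have [Tz _] : T n1 (x - (y + phi a *: g)) /\ span phi s (x - (y + phi a *: g)).
    apply/(H1 n n1'); split.
      by apply: (ksubB phiP (kT n)) => //; apply: mn.
    by rewrite opprD addrCA addrC; apply: (ksubB phiP kS).
  have [Tz' _] : T m (x - (y + phi a *: g)) /\ span phi s (x - (y + phi a *: g)).
    by apply/(H1 m m1); split=> //; rewrite opprD addrCA addrC; apply: (ksubB phiP kS).
  by rewrite -(subrK (y + phi a *: g) x); apply: TmD.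
exists (maxn n1 n2) => m; rewrite geq_max => /andP[m1 m2] x.
have [l r] := (leq_maxl n1 n2, leq_maxr n1 n2).
have [sub|sub] := monotone_cmp (maxn n1 n2) m monoT.
  by split; [apply: sub|apply: key sub x].
by split; [apply: key sub x|apply: sub].
Qed.

Definition kfin (M : lmodType R) : Prop := exists s : seq M, forall x, span phi s x.

(** A finitely spanned submodule of [S] which is maximal is all of [S]. *)
Lemma kfin_sub (M : lmodType R) (S : M -> Prop) : kfin M -> ksub phi S ->
  exists2 t : seq M, (forall y, y \in t -> S y) & forall x, S x -> span phi t x.
Proof.
move=> [s Hs] kS.
case: (@minimal_exists (seq M) (fun t => forall y, y \in t -> S y)
  (fun t' t => (forall x, span phi t x -> span phi t' x) /\
               exists2 x, span phi t' x & ~ span phi t x) _ [::]) => //.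
  move=> u Su lt.
  have [||n Hn] := @span_stable M s (fun n => span phi (u n)) _ _ (fun _ x _ => Hs x).
  - by move=> n; apply: span_ksub.
  - by left=> n; apply: (lt n).1.
  by case: (lt n) => _ [x ux] []; apply/(Hn n.+1).
move=> t St tmax; exists t => // x Sx; apply: contrapT => ntx.
apply: (tmax (x :: t)).
  by move=> y; rewrite in_cons => /orP[/eqP->//|]; apply: St.
split; first by move=> y; apply: span_cons.
by exists x => //; apply: span_mem => //; rewrite mem_head.
Qed.

Hypothesis finR : exists rho : seq R, forall r : R^o, span phi (rho : seq R^o) r.

Lemma fg_kfin (M : lmodType R) : finitely_generated M -> kfin M.
Proof.
case: finR => rho Hrho [n [g Hg]].
pose T := [seq r *: y | r <- rho, y <- codom g].
have kT := span_ksub phiP T; have [T0 TD TZ] := kT.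
exists T => x; have [a ->] := Hg x; apply: (ksub_sum _ kT) => i _.
have := Hrho (a i).
apply: (@span_min k R phi R^o rho (fun r : R => span phi T (r *: g i))).
  split=> [|r r' Tr Tr'|b r Tr]; first by rewrite scale0r.
    by rewrite scalerDl; apply: TD.
  by rewrite -scalerA; apply: TZ.
move=> r rr; apply: span_mem => //.
by apply/allpairsP; exists (r, g i); rewrite rr codom_f.
Qed.

Lemma submod_ksub (M : lmodType R) (S : M -> Prop) : submod S -> ksub phi S.
Proof. by move=> /ksub_submod[S0 SD SZ]; split=> // a x; apply: SZ. Qed.

Lemma fg_chain_fin (M : lmodType R) : finitely_generated M -> chain_fin M.
Proof.
move=> /fg_kfin[s Hs] T subT mono; apply: (@span_stable M s) => // n.
exact/submod_ksub/subT.
Qed.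

Lemma submod_fg (M : lmodType R) (S : M -> Prop) : finitely_generated M -> submod S ->
  exists2 t : seq M, (forall y, y \in t -> S y) & forall x, S x -> span id t x.
Proof.
move=> /fg_kfin kM sS; have [t tS Ht] := kfin_sub kM (submod_ksub sS).
exists t => // x /Ht; apply: span_min.
  by apply: submod_ksub; apply/ksub_submod/span_ksub/id_scalar.
by move=> y ty; apply: span_mem => //; apply: id_scalar.
Qed.

(** Evaluation at the generators [c] of [C] embeds the homomorphisms into a
    power of [N]. *)
Lemma hom_kfin (C N : lmodType R) : finitely_generated C -> finitely_generated N ->
  exists n (g : 'I_n -> hom C N), forall h : hom C N,
    exists a : 'I_n -> k, forall x, h x = \sum_i phi (a i) *: g i x.
Proof.
move=> [m [c Hc]] fgN.
pose V := dsum (fun _ : 'I_m => N).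
pose ev (h : hom C N) : V := [ffun i => h (c i)].
pose S (v : V) := exists h, v = ev h.
have evD h h' : ev (h + h') = ev h + ev h'.
  by apply/ffunP => i; rewrite !ffunE homDE.
have ev_inj : injective ev.
  move=> h h' e; apply: homP => x; have [a ->] := Hc x; rewrite !hom_sum.
  apply: eq_bigr => i _; rewrite !hom_Z; congr (_ *: _).
  by have := congr1 (fun v : V => v i) e; rewrite !ffunE.
have lin a (h : hom C N) : linear (fun x => phi a *: h x).
  by move=> b x y; rewrite hom_P scalerDr !scalerA central.
have evZ a h : ev (linhom (lin a h)) = phi a *: ev h.
  by apply/ffunP => i; rewrite !ffunE.
have kS : ksub phi S.
  split; first by exists 0; apply/ffunP => i; rewrite !ffunE.
    by move=> _ _ [h ->] [h' ->]; exists (h + h').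
  by move=> a _ [h ->]; exists (linhom (lin a h)).
have [|t St Ht] := @kfin_sub V S _ kS; first exact/fg_kfin/fg_dsum.
have St' (i : 'I_(size t)) : {h | t`_i = ev h} by apply/cid/St/mem_nth.
exists (size t), (fun i => sval (St' i)) => h.
have [a Ha] := span_sum (Ht (ev h) (ex_intro _ h erefl)).
exists (fun i : 'I_(size t) => a i) => x.
have -> : h = \sum_(i < size t) linhom (lin (a i) (sval (St' i))).
  apply: ev_inj; rewrite Ha; elim/big_ind2: _ => //.
    by move=> v1 h1 v2 h2 -> ->; rewrite evD.
  by move=> i _; rewrite evZ -(svalP (St' i)).
by rewrite hom_sumE.
Qed.

End ArtinBase.

Record finite_over_artinian (k : comNzRingType) (R : pzRingType) (phi : k -> R) : Prop := {
  foa_art : artinian k;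
  foa_phi : scalar_map phi;
  foa_central : forall a r, phi a * r = r * phi a;
  foa_fin : exists rho : seq R, forall r : R^o, span phi (rho : seq R^o) r }.

Lemma artin_algebra_finite (k : comNzRingType) (L : algType k) :
  artin_algebra L -> finite_over_artinian (fun a : k => a%:A : L).
Proof.
case=> artk /fg_span[s Hs]; split=> //.
- by split=> [a b|a b|]; rewrite ?scalerDl ?scale1r // -scalerAl mul1r scalerA.
- by move=> a r; rewrite mulr_algl mulr_algr.
exists s => r; have := Hs r.
elim: s {Hs} r => [//|y s IH] r /= [a Ha]; exists a; apply: IH.
by rewrite [_ *: (y : L^o)]mulr_algl.
Qed.

(** An endomorphism of [X] is a combination of finitely many with coefficients in
    [k], so [End(X)^op] inherits everything that is assumed on [R]. *)
Lemma endo_finite (k : comNzRingType) (R : pzRingType) (phi : k -> R) (X : fgmod R) :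
  finite_over_artinian phi ->
  exists psi : k -> (endo X)^c, finite_over_artinian psi.
Proof.
case=> artk phiP central finR.
have lin a : linear (fun x : X => phi a *: x).
  by move=> b x y; rewrite scalerDr !scalerA central.
pose psi a : (endo X)^c := linhom (lin a).
have [n [g Hg]] := hom_kfin artk phiP central finR (fgmodP X) (fgmodP X).
have psiP : scalar_map psi.
  split=> [a b|a b|]; apply: homP => x.
  - exact: (etrans (congr1 (fun c => c *: x) (scalar_D phiP a b)) (scalerDl _ _ _)).
  - change (phi (a * b) *: x = phi b *: (phi a *: x)).
    by rewrite mulrC scalar_M // scalerA.
  - exact: (etrans (congr1 (fun c => c *: x) (scalar_1 phiP)) (scale1r x)).
exists psi; split=> //.
- by move=> a r; apply: homP => x; apply: (hom_Z (r : endo X)).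
exists [seq (g i : (endo X)^c) | i : 'I_n] => r.
have [a Ha] := Hg (r : endo X).
have -> : r = \sum_i psi (a i) *: (g i : ((endo X)^c)^o).
  apply: homP => x; rewrite Ha.
  rewrite (hom_sumE _ _ (fun i => psi (a i) *: (g i : ((endo X)^c)^o) : hom X X)).
  by apply: eq_bigr => i _; symmetry; apply: (hom_Z (g i)).
have [_ SD SZ] := span_ksub psiP [seq (g i : ((endo X)^c)^o) | i : 'I_n].
apply: ksub_sum => [|i _]; first exact: span_ksub.
by apply: SZ; apply: span_mem => //; apply: map_f; rewrite mem_enum.
Qed.

(** * Summands, indecomposables and Fitting's lemma *)

(** What the module theory needs of a ring. It holds for the algebra and for
    [End(X)^op], and everything about decompositions is proved from it once. In
    [ks_hom] the coefficients [a i] stand for scalars of a central subring; as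
    endomorphisms of [C] they can be mentioned without naming that ring. *)
Record krull_schmidt_ring (R : pzRingType) : Prop := KrullSchmidtRing {
  ks_chain : forall M : lmodType R, finitely_generated M -> chain_fin M;
  ks_sub : forall (M : lmodType R) (S : M -> Prop), finitely_generated M -> submod S ->
    exists2 t : seq M, (forall y, y \in t -> S y) & forall x, S x -> span id t x;
  ks_hom : forall C N : lmodType R, finitely_generated C -> finitely_generated N ->
    exists n (g : 'I_n -> hom C N), forall h : hom C N,
      exists a : 'I_n -> hom C C, h = \sum_i homc (g i) (a i) }.

Lemma finite_krull_schmidt (k : comNzRingType) (R : pzRingType) (phi : k -> R) :
  finite_over_artinian phi -> krull_schmidt_ring R.
Proof.
case=> artk phiP central finR; split=> [M|M S|C N fgC fgN].
- exact: (fg_chain_fin artk phiP finR).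
- exact: (submod_fg artk phiP finR).
have [n [g Hg]] := hom_kfin artk phiP central finR fgC fgN.
exists n, g => h; have [a Ha] := Hg h.
have lin i : linear (fun x : C => phi (a i) *: x).
  by move=> b x y; rewrite scalerDr !scalerA central.
exists (fun i => linhom (lin i)); apply: homP => x; rewrite Ha hom_sumE.
by apply: eq_bigr => i _; rewrite homcE linhomE hom_Z.
Qed.

Section Summands.
Variable R : pzRingType.
Implicit Types U V W M N : lmodType R.

Lemma direct_summandP M N :
  direct_summand M N <-> exists (i : hom M N) (p : hom N M), homc p i = hom1 M.
Proof.
split=> [[M' [f /bij_inverse[g [gf fg]]]]|[i [p pi]]].
  exists (homc g (pinl M M')), (homc (pfst M M') f).
  by rewrite -homcA (homcA f) fg hom1c pfst_inl.
have [|M' [j [inj im]]] := @sub_exists R N (fun x => p x = 0).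
  by split=> [|a x y px py]; rewrite ?hom_0 ?hom_P ?px ?py ?scaler0 ?addr0.
have piE x : p (i x) = x by rewrite -[RHS]hom1E -pi.
have [h Hh] : exists h : hom N M', homc j h = hom1 N - homc i p.
  apply: factor_mono => // x; apply/im.
  by rewrite homBE hom1E homcE hom_B piE subrr.
have jh x : j (h x) = x - i (p x) by rewrite -[j (h x)]homcE Hh.
have lf : linear (fun x => (p x, h x)) by move=> a x y; congr pair; rewrite hom_P.
exists M', (linhom lf); apply: inj_surj_bij => [x [px hx]|[y z]].
  by apply/eqP; rewrite -(subrK (i (p x)) x) -jh hx px !hom_0 addr0.
have pj u : p (j u) = 0 by apply/im; exists u.
exists (i y + j z); change ((p (i y + j z), h (i y + j z)) = (y, z)).
rewrite hom_D piE pj addr0; congr pair; apply: inj.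
by rewrite jh hom_D piE pj addr0 addrAC subrr add0r.
Qed.

Lemma summand_refl M : direct_summand M M.
Proof. by apply/direct_summandP; exists (hom1 M), (hom1 M); rewrite homc1. Qed.

Lemma summand_trans M N U :
  direct_summand M N -> direct_summand N U -> direct_summand M U.
Proof.
move=> /direct_summandP[i [p pi]] /direct_summandP[j [q qj]]; apply/direct_summandP.
by exists (homc j i), (homc p q); rewrite -homcA (homcA q) qj hom1c.
Qed.

Lemma iso_summand M N : isomorphic M N -> direct_summand M N.
Proof.
by case=> f /bij_inverse[g [gf fg]]; apply/direct_summandP; exists f, g.
Qed.

Lemma iso_refl M : isomorphic M M.
Proof. by exists (hom1 M), id. Qed.
Lemma iso_sym M N : isomorphic M N -> isomorphic N M.
Proof. by case=> f /bij_inverse[g [gf fg]]; exists g; apply: inverse_bij fg gf. Qed.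
Lemma iso_trans M N U : isomorphic M N -> isomorphic N U -> isomorphic M U.
Proof.
case=> f /bij_inverse[g [gf fg]] [f' /bij_inverse[g' [gf' fg']]].
exists (homc f' f); apply: (@inverse_bij _ _ _ _ (homc g g')).
  by rewrite -homcA (homcA g') gf' hom1c.
by rewrite -homcA (homcA f) fg hom1c.
Qed.

Lemma summand_fg M N : direct_summand M N -> finitely_generated N -> finitely_generated M.
Proof.
case/direct_summandP=> i [p pi]; apply: (fg_surj (f := p)) => x.
by exists (i x); rewrite -[RHS]hom1E -pi.
Qed.

Lemma zero_hom M : is_zero M <-> hom1 M = 0.
Proof.
split=> [zM|e x]; first by apply: homP => x; apply: zM.
by rewrite -[x]hom1E e.
Qed.

Lemma summand_zero M N : direct_summand M N -> is_zero N -> is_zero M.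
Proof.
case/direct_summandP=> i [p pi] zN x.
by rewrite -[x]hom1E -pi homcE (zN (i x)) hom_0.
Qed.

Lemma fst_summand M N : direct_summand M (M * N)%type.
Proof. by apply/direct_summandP; exists (pinl M N), (pfst M N); apply: pfst_inl. Qed.
Lemma snd_summand M N : direct_summand N (M * N)%type.
Proof. by apply/direct_summandP; exists (pinr M N), (psnd M N); apply: psnd_inr. Qed.
Lemma dsum_summand n (V : 'I_n -> lmodType R) i : direct_summand (V i) (dsum V).
Proof. by apply/direct_summandP; exists (incl V i), (proj V i); apply: proj_incl. Qed.

Lemma idem_split M (e : hom M M) : homc e e = e ->
  exists (A : lmodType R) (i : hom A M) (p : hom M A), homc p i = hom1 A /\ homc i p = e.
Proof.
move=> ee; have eeE x : e (e x) = e x by rewrite -[LHS]homcE ee.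
have [|A [i [inj im]]] := @sub_exists R M (fun x => e x = x).
  by split=> [|a x y ex ey]; rewrite ?hom_0 ?hom_P ?ex ?ey.
have [p ip] : exists p : hom M A, homc i p = e by apply: factor_mono => // x; apply/im.
exists A, i, p; split=> //; apply: homP => x; apply: inj.
by rewrite homcE -[LHS]homcE ip hom1E; apply/im; exists x.
Qed.

Lemma indecomposable_idem M (e : hom M M) :
  indecomposable M -> homc e e = e -> e = 0 \/ e = hom1 M.
Proof.
move=> [nz ind] ee; have [A [i [p [pi ip]]]] := idem_split ee.
have ff : homc (hom1 M - e) (hom1 M - e) = hom1 M - e.
  by rewrite homcBl !homcBr !hom1c homc1 ee subrr subr0.
have [B [j [q [qj jq]]]] := idem_split ff.
have isoM : isomorphic M (A * B)%type.
  have lf : linear (fun x => (p x, q x)) by move=> a x y; congr pair; rewrite hom_P.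
  exists (linhom lf); apply: (@inverse_bij _ _ _ _ (homc i (pfst A B) + homc j (psnd A B))).
    apply: homP => x; change (i (p x) + j (q x) = x).
    by rewrite -[i (p x)]homcE -[j (q x)]homcE ip jq homBE hom1E addrC subrK.
  have pj : homc p j = 0.
    rewrite -[p]hom1c -pi -homcA -[j]homc1 -qj -!homcA (homcA j) jq (homcA i p) ip.
    by rewrite (homcA e) homcBr homc1 ee subrr hom0c homc0.
  have qi : homc q i = 0.
    rewrite -[q]hom1c -qj -homcA -[i]homc1 -pi -!homcA (homcA i) ip (homcA j q) jq.
    by rewrite (homcA _ e) homcBl hom1c ee subrr hom0c homc0.
  apply: homP => -[y z]; change ((p (i y + j z), q (i y + j z)) = (y, z)).
  rewrite !hom_D -[p (i y)]homcE -[p (j z)]homcE -[q (i y)]homcE -[q (j z)]homcE.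
  rewrite pi pj qi qj.
  by rewrite !hom0E !hom1E addr0 add0r.
have [zA|zB] := ind _ _ isoM; [left|right].
  by rewrite -ip; apply: homP => x; rewrite homcE (zA (p x)) hom_0.
by apply/esym/eqP; rewrite -subr_eq0 -jq; apply/eqP/homP => x; rewrite homcE (zB (q x)) hom_0.
Qed.

Lemma idem_indecomposable M : ~ is_zero M ->
  (forall e : hom M M, homc e e = e -> e = 0 \/ e = hom1 M) -> indecomposable M.
Proof.
move=> nz idem; split=> // A B [f /bij_inverse[g [gf fg]]].
pose e := homc g (homc (homc (pinl A B) (pfst A B)) f).
have ee : homc e e = e.
  by rewrite /e -!homcA (homcA f) fg hom1c (homcA (pfst A B)) pfst_inl hom1c.
have [e0|e1] := idem e ee; [left|right] => x.
  have fgE z : f (g z) = z by rewrite -[LHS]homcE fg.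
  have : (f (e (g (x, 0)))).1 = x.
    by change ((f (g ((f (g (x, 0))).1, 0))).1 = x); rewrite !fgE.
  by rewrite e0 hom0E hom_0.
have fgE z : f (g z) = z by rewrite -[LHS]homcE fg.
have : (f (e (g (0, x)))).2 = 0.
  by change ((f (g ((f (g (0, x))).1, 0))).2 = 0); rewrite !fgE.
by rewrite e1 hom1E fgE.
Qed.

(** The idempotent [i p] of [V] is zero or one, and it is not zero. *)
Lemma summand_indecomposable U V (i : hom U V) (p : hom V U) :
  ~ is_zero U -> indecomposable V -> homc p i = hom1 U -> isomorphic U V.
Proof.
move=> nz ind pi.
have [|e0|e1] := indecomposable_idem (e := homc i p) ind.
- by rewrite -homcA (homcA p) pi hom1c.
- case: nz; apply/zero_hom.
  by rewrite -pi -[i]homc1 -pi (homcA i) e0 hom0c homc0.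
by exists i; apply: inverse_bij pi e1.
Qed.

Lemma indecomposable_iso M N : isomorphic M N -> indecomposable M -> indecomposable N.
Proof.
move=> MN [nz ind]; split=> [zN|A B NAB].
  by apply: nz; apply: summand_zero zN; apply: iso_summand.
exact/ind/(iso_trans MN).
Qed.

(** A weak form of a decomposition, with no orthogonality between different
    indices. It is what the Krull-Schmidt argument uses, it passes to summands,
    and additive functors preserve it. *)
Definition id_factors M (I : finType) (V : I -> lmodType R) : Prop :=
  exists (i : forall j, hom (V j) M) (p : forall j, hom M (V j)),
    \sum_j homc (i j) (p j) = hom1 M.

Lemma dsum_id_factors n (V : 'I_n -> lmodType R) : id_factors (dsum V) V.
Proof. by exists (incl V), (proj V); apply: sum_incl_proj. Qed.

Lemma id_factors_summand M N (I : finType) (V : I -> lmodType R) :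
  direct_summand M N -> id_factors N V -> id_factors M V.
Proof.
case/direct_summandP=> i [p pi] [a [b ab]].
exists (fun j => homc p (a j)), (fun j => homc (b j) i).
under eq_bigr do rewrite -homcA (homcA (a _)).
by rewrite -homc_sumr -homc_suml ab hom1c.
Qed.

Lemma id_factors_iso M (I : finType) (V W : I -> lmodType R) :
  (forall j, isomorphic (V j) (W j)) -> id_factors M V -> id_factors M W.
Proof.
move=> VW [a [b ab]].
have c j : {f : hom (V j) (W j) & {g : hom (W j) (V j) | homc g f = hom1 (V j)}}.
  have [f H] := cid (VW j); exists f; apply: cid.
  by have [g [gf _]] := bij_inverse H; exists g.
exists (fun j => homc (a j) (sval (projT2 (c j)))), (fun j => homc (projT1 (c j)) (b j)).
rewrite -ab; apply: eq_bigr => j _.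
by rewrite -homcA (homcA (sval _)) (svalP (projT2 (c j))) hom1c.
Qed.

(** The orthogonality missing in [id_factors] is that of the places [s i]. *)
Lemma id_factors_dsum M (I : finType) n (V : 'I_n -> lmodType R) (s : I -> 'I_n) :
  injective s -> id_factors M (fun i => V (s i)) -> direct_summand M (dsum V).
Proof.
move=> injs [a [b ab]]; apply/direct_summandP.
exists (\sum_i homc (incl V (s i)) (b i)), (\sum_i homc (a i) (proj V (s i))).
rewrite homc_suml -ab; apply: eq_bigr => i _; rewrite homc_sumr (bigD1 i) //= big1.
  by rewrite addr0 -homcA (homcA (proj _ _)) proj_incl hom1c.
move=> j ji; rewrite -homcA (homcA (proj _ _)) proj_incl_neq ?hom0c ?homc0 //.
by apply: contra ji => /eqP/injs ->.
Qed.

End Summands.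

Section Fitting.
Variables (R : pzRingType).
Implicit Types M W : lmodType R.

Definition hpow M (g : hom M M) n : hom M M := iter n (homc g) (hom1 M).

Lemma hpowD M (g : hom M M) m n : hpow g (m + n) = homc (hpow g m) (hpow g n).
Proof. by elim: m => [|m IH]; rewrite ?hom1c // addSn /= IH homcA. Qed.

Lemma hpow_stable M (g : hom M M) : chain_fin M ->
  exists n, [/\ (0 < n)%N, forall x, hpow g (n + n) x = 0 -> hpow g n x = 0 &
    forall x, exists y, hpow g n x = hpow g (n + n) y].
Proof.
move=> chM.
have [||n1 H1] := chM (fun n x => hpow g n x = 0).
- by move=> n; split=> [|a x y gx gy]; rewrite ?hom_0 // hom_P gx gy scaler0 addr0.
- by left=> n x gx; rewrite /= gx hom_0.
have [||n2 H2] := chM (fun n x => exists y, hpow g n y = x).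
- move=> n; split=> [|a _ _ [x <-] [y <-]]; first by exists 0; rewrite hom_0.
  by exists (a *: x + y); rewrite hom_P.
- by right=> n _ [x <-]; exists (g x); rewrite -[LHS]homcE -addn1 hpowD.
pose n := (n1 + n2).+1.
have l1 : (n1 <= n)%N by rewrite leqW ?leq_addr.
have l2 : (n2 <= n)%N by rewrite leqW ?leq_addl.
exists n; split=> // [x gx|x].
  by apply/(H1 n l1)/(H1 (n + n)%N); rewrite // (leq_trans l1) ?leq_addl.
have [y gy] : exists y, hpow g (n + n) y = hpow g n x.
  by apply/(H2 (n + n)%N); [rewrite (leq_trans l2) ?leq_addl|apply/(H2 n l2); exists x].
by exists y.
Qed.

(** For large [n] the module is the direct sum of the image and the kernel of
    [g ^ n]; [e] is the projection onto the image. On an indecomposable module it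
    is trivial, so that [g] is nilpotent or bijective. The last property, that
    [e] fixes every map fixed by [g], serves for minimal approximations. *)
Lemma fitting M (g : hom M M) : chain_fin M ->
  exists e : hom M M, [/\ homc e e = e,
    e = 0 -> exists n, hpow g n = 0,
    e = hom1 M -> bijective g &
    forall U (h : hom U M), homc g h = h -> homc e h = h].
Proof.
move=> chM; have [n [n0 ker im]] := hpow_stable g chM.
have nn x : hpow g (n + n) x = hpow g n (hpow g n x) by rewrite hpowD.
pose r x y := exists z, hpow g n x = hpow g (n + n) z /\ y = hpow g n z.
have [|y|a x y x' y'|e He] := @hom_of_rel R M M r.
- by move=> x; have [z gz] := im x; exists (hpow g n z), z.
- by case=> z [+ ->]; rewrite hom_0 => /esym/ker.
- case=> z [gz ->] [z' [gz' ->]]; exists (a *: z + z').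
  by rewrite !hom_P gz gz'.
have uniq x z : hpow g n x = hpow g n (hpow g n z) -> e x = hpow g n z.
  move=> xz; have [z' [gz' ->]] := He x; apply/eqP; rewrite -subr_eq0 -hom_B.
  by apply/eqP/ker; rewrite hom_B -gz' xz nn subrr.
have gE x : hpow g n (e x) = hpow g n x by have [z [-> ->]] := He x; rewrite nn.
exists e; split.
- by apply: homP => x; have [z [_ ez]] := He x; rewrite homcE ez; apply: uniq.
- by move=> e0; exists n; apply: homP => x; rewrite -gE e0 hom_0.
- move=> e1; apply: inj_surj_bij => [x gx|y].
    rewrite -[x]hom1E -e1 -(hom_0 (hpow g n)); apply: uniq.
    by rewrite !hom_0 -(prednK n0) -addn1 hpowD homcE /= gx !hom_0.
  have [z [_]] := He y; rewrite e1 hom1E => ->.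
  by exists (hpow g n.-1 z); rewrite -[in RHS](prednK n0).
move=> U h gh; apply: homP => x; rewrite homcE.
have gn m : hpow g m (h x) = h x.
  by elim: m => [//|m IH]; rewrite /= IH -[LHS]homcE gh.
by rewrite -[in RHS](gn n); apply: uniq; rewrite !gn.
Qed.

Lemma inj_endo_bij M (g : hom M M) : chain_fin M ->
  (forall x, g x = 0 -> x = 0) -> bijective g.
Proof.
move=> chM inj; apply: inj_surj_bij => // y.
have injn m x : hpow g m x = 0 -> x = 0 by elim: m => [//|m IH] /= /inj /IH.
have [n [n0 _ im]] := hpow_stable g chM; have [z Hz] := im y.
exists (hpow g n.-1 z).
have gz : g (hpow g n.-1 z) = hpow g n z by rewrite -[in RHS](prednK n0).
apply/eqP; rewrite -subr_eq0; apply/eqP/(injn n).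
by rewrite hom_B gz Hz hpowD homcE subrr.
Qed.

Lemma summand_antisym M N : chain_fin M ->
  direct_summand M N -> direct_summand N M -> isomorphic M N.
Proof.
move=> chM /direct_summandP[i [p pi]] /direct_summandP[j [q qj]].
have [|h hK hK'] := @inj_endo_bij M (homc j i) chM.
  move=> x jix; rewrite -[x]hom1E -pi homcE -[i x]hom1E -qj homcE.
  by rewrite -[j (i x)]homcE jix !hom_0.
exists i; apply: inj_surj_bij => [x ix|y].
  by rewrite -[x]hom1E -pi homcE ix hom_0.
exists (h (j y)); rewrite -[LHS]hom1E -qj homcE -[j (i _)]homcE hK'.
by rewrite -[q _]homcE qj.
Qed.

Lemma bij_or_nilpotent W (g : hom W W) : chain_fin W -> indecomposable W ->
  bijective g \/ exists n, hpow g n = 0.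
Proof.
move=> chW ind; have [e [ee e0 e1 _]] := fitting g chW.
by case: (indecomposable_idem ind ee) => [/e0|/e1]; [right|left].
Qed.

(** The endomorphism ring of an indecomposable module is local: if [u] inverts
    [f + g], then [u f] and [u g] add up to the identity and cannot both be
    nilpotent. *)
Lemma bij_sum2 W (f g : hom W W) : chain_fin W -> indecomposable W ->
  bijective (f + g) -> bijective f \/ bijective g.
Proof.
move=> chW ind /bij_inverse[u [ufg fgu]].
have red (h : hom W W) : bijective (homc u h) -> bijective h.
  move=> b; rewrite -[h]hom1c -fgu -homcA.
  apply: (@bij_comp _ _ _ (f + g) (homc u h)) => //.
  exact: inverse_bij ufg fgu.
have [/red|[n n0]] := bij_or_nilpotent (homc u f) chW ind; first by left.
have [/red|[m m0]] := bij_or_nilpotent (homc u g) chW ind; first by right.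
have injf : forall x, homc u f x = 0 -> x = 0.
  move=> x ufx; have gx : homc u g x = x.
    by rewrite -[RHS]hom1E -ufg homcDr homDE ufx add0r.
  rewrite -[RHS](hom0E W x) -m0; elim: m {m0} => [//|m IH].
  by change (x = homc u g (hpow (homc u g) m x)); rewrite -IH gx.
case: ind => nz _; case: nz => x.
suff inj j y : hpow (homc u f) j y = 0 -> y = 0 by apply: (inj n); rewrite n0.
by elim: j => [//|j IH] /= /injf /IH.
Qed.

Lemma bij_sum W I (r : seq I) (f : I -> hom W W) : chain_fin W -> indecomposable W ->
  bijective (\sum_(i <- r) f i) -> exists i, bijective (f i).
Proof.
move=> chW ind; elim: r => [|i r IH].
  rewrite big_nil => /bij_inverse[g [g0 _]].
  by case: ind.1; apply/zero_hom; rewrite -g0 homc0.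
by rewrite big_cons => /(bij_sum2 chW ind)[b|/IH//]; exists i.
Qed.

End Fitting.

(** * Decomposition and generation of finitely generated modules *)

Section FinitelyGenerated.
Variable R : pzRingType.
Hypothesis ksR : krull_schmidt_ring R.
Implicit Types M N W : fgmod R.

Lemma fg_power M n : finitely_generated (power n M).
Proof. by apply: fg_dsum => i; apply: fgmodP. Qed.
Definition fpower n M : fgmod R := Fgmod (fg_power M n).
Definition fpair M N : fgmod R := Fgmod (fg_pair (fgmodP M) (fgmodP N)).

Lemma fg_summand (U : lmodType R) M :
  direct_summand U M -> exists W : fgmod R, isomorphic U W.
Proof.
move=> sU; have fgU := summand_fg sU (fgmodP M).
by exists (Fgmod fgU); apply: iso_refl.
Qed.

Lemma sub_fg M (S : M -> Prop) : submod S -> exists (K : fgmod R) (i : hom K M),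
  injective i /\ forall x, S x <-> exists y, i y = x.
Proof.
move=> subS; have [A [i [inj im]]] := sub_exists subS.
have [t tS Ht] := ks_sub ksR (fgmodP M) subS.
have fgA : finitely_generated A.
  apply/fg_span.
  have pre y : exists a, y \in t -> i a = y.
    have [/tS/im[a ia]|_] := boolP (y \in t); first by exists a.
    by exists 0.
  have [f Hf] := choice pre.
  exists (map f t) => a.
  have /Ht : S (i a) by apply/im; exists a.
  have E : t = map i (map f t).
    by rewrite -map_comp [RHS]map_id_in // => y /Hf.
  rewrite {1}E.
  elim: (map f t) a => [|b s IH] a /=; first by move=> ia; apply: inj; rewrite ia hom_0.
  by case=> c Hc; exists c; apply: IH; rewrite hom_B hom_Z.
by exists (Fgmod fgA), i.
Qed.

Lemma ker_fg M (N : lmodType R) (f : hom M N) : exists (K : fgmod R) (i : hom K M),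
  injective i /\ forall x, f x = 0 <-> exists y, i y = x.
Proof.
apply: (@sub_fg M (fun x => f x = 0)).
by split=> [|a x y fx fy]; rewrite ?hom_0 // hom_P fx fy scaler0 addr0.
Qed.

Lemma quot_fg M (S : M -> Prop) : submod S -> exists (Q : fgmod R) (p : hom M Q),
  (forall y, exists x, p x = y) /\ forall x, p x = 0 <-> S x.
Proof.
move=> subS; have [A [p [surj ker]]] := quot_exists subS.
by exists (Fgmod (fg_surj surj (fgmodP M))), p.
Qed.

Lemma universal_map M N : exists n (g : hom (power n M) N),
  forall h : hom M N, exists s : hom M (power n M), homc g s = h.
Proof.
have [n [g Hg]] := ks_hom ksR (fgmodP M) (fgmodP N).
exists n, (\sum_i homc (g i) (proj (fun=> M : lmodType R) i)) => h.
have [a ->] := Hg h.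
exists (\sum_i homc (incl (fun=> M : lmodType R) i) (a i)).
rewrite homc_suml; apply: eq_bigr => i _.
rewrite -homcA homc_sumr (bigD1 i) //= big1 => [|j ji].
  by rewrite addr0 (homcA (proj _ _)) proj_incl hom1c.
by rewrite homcA proj_incl_neq ?hom0c.
Qed.

Definition decomposable (U : lmodType R) : Prop :=
  exists (I : finType) (V : I -> lmodType R),
    [/\ forall j, indecomposable (V j), forall j, direct_summand (V j) U & id_factors U V].

Lemma decomposable_sum (U A B : lmodType R) (f : hom U (A * B)%type) : bijective f ->
  decomposable A -> decomposable B -> decomposable U.
Proof.
move=> bf [I [V [indV sumV [a [b ab]]]]] [J [V' [indV' sumV' [c [d cd]]]]].
have [g [gf fg]] := bij_inverse bf.
have UAB : isomorphic U (A * B)%type by exists f.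
have sAB := iso_summand (iso_sym UAB).
pose VV (j : I + J) := match j with inl i => V i | inr i => V' i end.
exists (I + J)%type, VV; split.
- by case.
- case=> j; apply: summand_trans sAB.
    by apply: summand_trans (sumV j) _; apply: fst_summand.
  by apply: summand_trans (sumV' j) _; apply: snd_summand.
exists (fun j => match j return hom (VV j) U with
  | inl i => homc (homc g (pinl A B)) (a i) | inr i => homc (homc g (pinr A B)) (c i) end).
exists (fun j => match j return hom U (VV j) with
  | inl i => homc (b i) (homc (pfst A B) f) | inr i => homc (d i) (homc (psnd A B) f) end).
rewrite big_sumType /=.
under eq_bigr do rewrite -homcA (homcA (a _)).
rewrite -homc_sumr -homc_suml ab hom1c.
under eq_bigr do rewrite -homcA (homcA (c _)).
rewrite -homc_sumr -homc_suml cd hom1c.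
by rewrite -!homcA -homcDr !homcA -homcDl sum_pair hom1c gf.
Qed.

(** The descending chain condition is applied to the images of the summands that
    do not decompose. *)
Lemma fg_decomposable M : decomposable M.
Proof.
apply: contrapT => nd.
pose D (S : M -> Prop) := exists (A : lmodType R) (i : hom A M) (p : hom M A),
  [/\ homc p i = hom1 A, forall x, S x <-> exists y, i y = x & ~ decomposable A].
case: (@minimal_exists _ D (fun S' S => (forall x, S' x -> S x) /\ exists2 x, S x & ~ S' x)
  _ (fun=> True)).
- move=> u Du lt; have [||n Hn] := ks_chain ksR (fgmodP M) (T := u).
  + move=> n; have [A [i [p [_ im _]]]] := Du n; split.
      by apply/im; exists 0; rewrite hom_0.
    by move=> a x y /im[x' <-] /im[y' <-]; apply/im; exists (a *: x' + y'); rewrite hom_P.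
  + by right=> n; apply: (lt n).1.
  by case: (lt n) => _ [x ux []]; apply/(Hn n.+1).
- exists M, (hom1 M), (hom1 M); split=> // [|x]; first by rewrite homc1.
  by split=> // _; exists x.
move=> S [A [i [p [pi im ndA]]]] Smin.
have piE x : p (i x) = x by rewrite -[LHS]homcE pi.
have nzA : ~ is_zero A.
  move=> /zero_hom zA; apply: ndA; exists 'I_0, (fun=> A); split; try by case.
  by exists (fun=> 0), (fun=> 0); rewrite big_ord0 zA.
have nindA : ~ indecomposable A.
  move=> indA; apply: ndA; exists unit, (fun=> A); split=> //.
    by move=> _; apply: summand_refl.
  by exists (fun=> hom1 A), (fun=> hom1 A); rewrite big_const card_unit /= addr0 homc1.
apply: nindA; split=> // B C [f bf]; apply: contrapT => /not_orP[nzB nzC].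
have [g [gf fg]] := bij_inverse bf.
have gK z : f (g z) = z by rewrite -[LHS]homcE fg.
apply: ndA; apply: (decomposable_sum bf); apply: contrapT => nd'.
  apply: (Smin (fun x => exists y, i (g (y, 0)) = x)).
    exists B, (homc i (homc g (pinl B C))), (homc (homc (pfst B C) f) p).
    split=> //; apply: homP => y.
    by change ((f (p (i (g (y, 0))))).1 = y); rewrite piE gK.
  split=> [_ [y <-]|]; first by apply/im; exists (g (y, 0)).
  apply: contrapT => no; apply: nzC => z; apply: contrapT => z0; apply: no.
  exists (i (g (0, z))); first by apply/im; exists (g (0, z)).
  by case=> y /(congr1 (fun x => (f (p x)).2)); rewrite !piE !gK => /esym/z0.
apply: (Smin (fun x => exists y, i (g (0, y)) = x)).
  exists C, (homc i (homc g (pinr B C))), (homc (homc (psnd B C) f) p).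
  split=> //; apply: homP => y.
  by change ((f (p (i (g (0, y))))).2 = y); rewrite piE gK.
split=> [_ [y <-]|]; first by apply/im; exists (g (0, y)).
apply: contrapT => no; apply: nzB => z; apply: contrapT => z0; apply: no.
exists (i (g (z, 0))); first by apply/im; exists (g (z, 0)).
by case=> y /(congr1 (fun x => (f (p x)).1)); rewrite !piE !gK => /esym/z0.
Qed.

Lemma indecomposable_summand M : ~ is_zero M ->
  exists2 W : fgmod R, indecomposable W & direct_summand W M.
Proof.
move=> nz; have [I [V [indV sumV [a [b ab]]]]] := fg_decomposable M.
have [[j _]|no] := pselect (exists j : I, True); last first.
  case: nz; apply/zero_hom; rewrite -ab big1 // => j _.
  by case: no; exists j.
have [W VW] := fg_summand (sumV j).
exists W; first exact: indecomposable_iso (indV j).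
exact: summand_trans (iso_summand (iso_sym VW)) (sumV j).
Qed.

(** The identity of [W] is a sum of maps through the [V j]; as the endomorphism
    ring of [W] is local, one of them is bijective. *)
Lemma krull_schmidt W (M : lmodType R) (I : finType) (V : I -> lmodType R) n :
  indecomposable W -> (forall j, indecomposable (V j)) -> id_factors M V ->
  direct_summand W (power n M) -> exists j, isomorphic W (V j).
Proof.
move=> indW indV [a [b ab]] /direct_summandP[i [p pi]].
have chW := ks_chain ksR (fgmodP W).
pose P := fun _ : 'I_n => M.
have bij1 : bijective (\sum_k homc (homc p (incl P k)) (homc (proj P k) i)).
  under eq_bigr do rewrite -homcA (homcA (incl _ _)).
  by rewrite -homc_sumr -homc_suml sum_incl_proj hom1c pi; exists id.
have [k bk] := bij_sum chW indW bij1.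
have bij2 : bijective (\sum_j homc (homc (homc p (incl P k)) (a j))
                                   (homc (b j) (homc (proj P k) i))).
  under eq_bigr do rewrite -homcA (homcA (a _)).
  by rewrite -homc_sumr -homc_suml ab hom1c.
have [j /bij_inverse[u [uab _]]] := bij_sum chW indW bij2.
exists j; apply: (summand_indecomposable (p := homc u (homc (homc p (incl P k)) (a j)))).
- exact: indW.1.
- exact: indV.
by rewrite -homcA; exact: uab.
Qed.

Lemma gen_maps (N : lmodType R) M (I : finType) (g : I -> hom N M) :
  (forall y, exists x : I -> N, y = \sum_i g i (x i)) -> gen N M.
Proof.
move=> H; pose P := fun _ : 'I_#|I| => N.
exists #|I|, (\sum_j homc (g (enum_val j)) (proj P j)) => y.
have [x ->] := H y; exists ([ffun j => x (enum_val j)] : dsum P).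
rewrite hom_sumE [RHS](reindex (fun j : 'I_#|I| => enum_val j)) /=; last first.
  by apply: onW_bij; apply: enum_val_bij.
by apply: eq_bigr => j _; rewrite ffunE.
Qed.

Lemma genP (N : lmodType R) M : gen N M ->
  exists n (g : 'I_n -> hom N M), forall y, exists x : 'I_n -> N, y = \sum_i g i (x i).
Proof.
case=> n [g Hg]; exists n, (fun i => homc g (incl (fun=> N) i)) => y.
have [x <-] := Hg y; exists (fun i => x i).
by rewrite -{1}[x]hom1E -sum_incl_proj hom_sumE hom_sum.
Qed.

Lemma gen_surj (N : lmodType R) M W (f : hom M W) :
  (forall y, exists x, f x = y) -> gen N M -> gen N W.
Proof.
move=> surj [n [g Hg]]; exists n, (homc f g) => y.
by have [x <-] := surj y; have [z <-] := Hg x; exists z.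
Qed.

Lemma gen_refl M : gen M M.
Proof.
apply: (gen_maps (I := unit) (g := fun=> hom1 M)) => y; exists (fun=> y).
by rewrite big_const card_unit /= addr0.
Qed.

Lemma gen_trans (N : lmodType R) M W : gen N M -> gen M W -> gen N W.
Proof.
move=> /genP[n [g Hg]] /genP[m [h Hh]].
apply: (gen_maps (I := ('I_m * 'I_n)%type) (g := fun ij => homc (h ij.1) (g ij.2))) => y.
have [x ->] := Hh y; have [z Hz] := choice (fun i => Hg (x i)).
exists (fun ij => z ij.1 ij.2).
rewrite -(pair_bigA _ (fun i j => homc (h i) (g j) (z i j))) /=.
by apply: eq_bigr => i _; rewrite {1}(Hz i) hom_sum.
Qed.

Lemma gen_summand (N : lmodType R) M W : direct_summand W M -> gen N M -> gen N W.
Proof.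
case/direct_summandP=> i [p pi]; apply: (gen_surj (f := p)) => x.
by exists (i x); rewrite -[LHS]homcE pi.
Qed.

Lemma gen_power (N : lmodType R) M n : gen N M -> gen N (fpower n M).
Proof.
move=> /gen_trans; apply; pose P := fun _ : 'I_n => M : lmodType R.
apply: (@gen_maps M (fpower n M) _ (fun i : 'I_n => incl P i)) => y; exists (fun i => y i).
by rewrite -{1}[y]hom1E -[hom1 _]sum_incl_proj hom_sumE.
Qed.

End FinitelyGenerated.

(** [pick] depends only on the extension of its predicate, so that equivalent
    indices get the same representative. *)
Lemma representatives (T : Type) (E : T -> T -> Prop) (Q : T -> Prop)
    (I : finType) (V : I -> T) :
  (forall x, E x x) -> (forall x y, E x y -> E y x) ->
  (forall x y z, E x y -> E y z -> E x z) -> (forall x y, E x y -> Q x -> Q y) ->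
  exists n (f : 'I_n -> I), [/\ forall i, Q (V (f i)),
    forall i j, i != j -> ~ E (V (f i)) (V (f j)) &
    forall i, Q (V i) -> exists j, E (V i) (V (f j))].
Proof.
move=> Er Es Et QE.
pose r i := odflt i [pick j | `[<E (V i) (V j)>]].
have rE i : E (V i) (V (r i)).
  by rewrite /r; case: pickP => [j /asboolP//|/(_ i)/asboolP []].
have r_eq i j : E (V i) (V j) -> r i = r j.
  move=> ij; have e : (fun l => `[<E (V i) (V l)>]) =1 (fun l => `[<E (V j) (V l)>]).
    by move=> l; apply/asboolP/asboolP; apply: Et; [apply: Es|].
  rewrite /r (eq_pick e); case: pickP => [//|/(_ j)/asboolP []]; exact: Er.
pose A := [set i | `[<Q (V i)>] && (r i == i)].
exists #|A|, (fun a => enum_val a); split.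
- by move=> a; have := enum_valP a; rewrite inE => /andP[/asboolP].
- move=> a b ab /r_eq; have := enum_valP a; have := enum_valP b.
  rewrite !inE => /andP[_ /eqP ->] /andP[_ /eqP ->] /enum_val_inj e.
  by rewrite e eqxx in ab.
move=> i Qi; have ri : r i \in A.
  rewrite inE -(r_eq _ _ (rE i)) eqxx andbT; apply/asboolP.
  exact: QE (rE i) Qi.
by exists (enum_rank_in ri (r i)); rewrite enum_rankK_in.
Qed.

(** * The functor Hom(X, -) and the relative exact structure *)

Section Dictionary.
Variables (R : pzRingType) (X : fgmod R).
Hypotheses (ksR : krull_schmidt_ring R) (hX : additive_generator X).
Implicit Types (A B C M N W Z : fgmod R) (U V : lmodType R).

Local Notation Gam := ((endo X)^c).
Local Notation H U := (hom X U : lmodType Gam).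

Lemma Hscale U (a : Gam) (h : hom X U) : a *: (h : H U) = homc h (a : endo X).
Proof. by []. Qed.

Lemma Hmap_linear U V (u : hom U V) :
  linear ((fun h : hom X U => homc u h) : H U -> H V).
Proof. by move=> a h h'; rewrite homcDr !Hscale homcA. Qed.
Definition Hmap U V (u : hom U V) : hom (H U) (H V) := linhom (Hmap_linear u).

Lemma HmapE U V (u : hom U V) (h : hom X U) : Hmap u h = homc u h.
Proof. by []. Qed.
Lemma Hmap1 U : Hmap (hom1 U) = hom1 (H U).
Proof. by apply: homP => h; rewrite HmapE hom1c. Qed.
Lemma Hmapc U V T (u : hom V T) (v : hom U V) : Hmap (homc u v) = homc (Hmap u) (Hmap v).
Proof. by apply: homP => h; rewrite HmapE -homcA. Qed.
Lemma Hmap0 U V : Hmap (0 : hom U V) = 0.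
Proof. by apply: homP => h; rewrite HmapE hom0c. Qed.
Lemma Hmap_sum U V I (r : seq I) (f : I -> hom U V) :
  Hmap (\sum_(i <- r) f i) = \sum_(i <- r) Hmap (f i).
Proof. by apply: homP => h; rewrite HmapE homc_suml hom_sumE. Qed.

Lemma H_fg M : finitely_generated (H M).
Proof.
have [n [g Hg]] := ks_hom ksR (fgmodP X) (fgmodP M).
by exists n, g => h; have [a ->] := Hg h; exists a.
Qed.
Definition Hfg M : fgmod Gam := Fgmod (H_fg M).

Lemma X_generates M x : exists n (h : 'I_n -> hom X M) (t : 'I_n -> X),
  x = \sum_i h i (t i).
Proof. by have [n [h Hh]] := genP (hX M); have [t ->] := Hh x; exists n, h, t. Qed.

Lemma H_faithful M U (u v : hom M U) : (forall h : hom X M, homc u h = homc v h) -> u = v.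
Proof.
move=> uv; apply: homP => x; have [n [h [t ->]]] := X_generates x.
by rewrite !hom_sum; apply: eq_bigr => i _; rewrite -!homcE uv.
Qed.

Lemma lift_surj M N (g : hom M N) :
  (forall h : hom X N, exists s, homc g s = h) -> forall y, exists x, g x = y.
Proof.
move=> Hg y; have [m [h [t ->]]] := X_generates y.
have [s Hs] := choice (fun i => Hg (h i)).
by exists (\sum_i s i (t i)); rewrite hom_sum; apply: eq_bigr => i _; rewrite -Hs.
Qed.

(** [p] presents [M] by a power of [X]. The images under [eta] of its components
    define a map on that power, which kills the kernel of [p] because [X]
    generates it. *)
Lemma H_full M U (eta : hom (H M) (H U)) : exists u : hom M U, eta = Hmap u.
Proof.
have [n [p Hp]] := universal_map ksR X M.
have surj := @lift_surj (fpower n X) M p Hp.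
pose P := fun _ : 'I_n => X : lmodType R.
pose pi i : H M := homc p (incl P i).
pose v : hom (power n X) U := \sum_i homc (eta (pi i) : hom X U) (proj P i).
have comb (s : hom X (power n X)) : eta (homc p s : H M) = homc v s.
  have -> : (homc p s : H M) = \sum_i (homc (proj P i) s : Gam) *: pi i.
    rewrite -[s in LHS]hom1c -[hom1 _]sum_incl_proj homc_suml homc_sumr.
    by apply: eq_bigr => i _; rewrite Hscale /pi !homcA.
  rewrite hom_sum homc_suml; apply: eq_bigr => i _.
  by rewrite hom_Z Hscale homcA.
have [|u Hu] := factor_epi (h := v) surj.
  have [K [i [inj ker]]] := ker_fg ksR p (M := fpower n X).
  move=> x /ker[y <-]; rewrite -[LHS]homcE -[RHS](hom0E U y); congr ((_ : hom K U) y).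
  apply: H_faithful => h; rewrite -homcA -comb homcA.
  have -> : homc p i = 0 by apply: homP => z; apply/ker; exists z.
  by rewrite !hom0c hom_0.
exists u; apply: homP => h; have [s <-] := Hp h.
by rewrite HmapE comb homcA Hu.
Qed.

Lemma H_iso M N : isomorphic (H M) (H N) -> isomorphic M N.
Proof.
case=> f /bij_inverse[g [gf fg]].
have [u Hu] := H_full f; have [v Hv] := H_full g.
exists u; apply: (@inverse_bij _ _ _ _ v); apply: H_faithful => h.
  by have := congr1 (fun k : hom _ _ => k h) gf; rewrite Hu Hv -Hmapc HmapE => ->; rewrite hom1c.
by have := congr1 (fun k : hom _ _ => k h) fg; rewrite Hu Hv -Hmapc HmapE => ->; rewrite hom1c.
Qed.

Lemma H_summand U V : direct_summand U V -> direct_summand (H U) (H V).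
Proof.
move=> /direct_summandP[i [p pi]]; apply/direct_summandP.
by exists (Hmap i), (Hmap p); rewrite -Hmapc pi Hmap1.
Qed.

Lemma iso_H U V : isomorphic U V -> isomorphic (H U) (H V).
Proof.
case=> f /bij_inverse[g [gf fg]]; exists (Hmap f).
by apply: (@inverse_bij _ _ _ _ (Hmap g)); rewrite -Hmapc ?gf ?fg Hmap1.
Qed.

Lemma H_id_factors U (I : finType) (V : I -> lmodType R) :
  id_factors U V -> id_factors (H U) (fun i => H (V i)).
Proof.
case=> a [b ab]; exists (fun i => Hmap (a i)), (fun i => Hmap (b i)).
by rewrite -Hmap1 -ab Hmap_sum; apply: eq_bigr => i _; rewrite Hmapc.
Qed.

Lemma H_zero M : is_zero (H M) -> is_zero M.
Proof.
move=> zH; apply/zero_hom/H_faithful => h.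
by rewrite hom1c hom0c; apply: zH.
Qed.

Lemma H_indecomposable M : indecomposable M -> indecomposable (H M).
Proof.
move=> indM; apply: idem_indecomposable => [/H_zero zM|e ee]; first exact: indM.1.
have [u eu] := H_full e.
have uu : homc u u = u.
  by apply: H_faithful => h; rewrite -!HmapE -eu -[in RHS]ee eu Hmapc.
rewrite eu; case: (indecomposable_idem indM uu) => ->; [left|right].
  exact: Hmap0.
exact: Hmap1.
Qed.

Lemma add_X : add X X.
Proof.
exists 1%N; exact: (@dsum_summand _ _ (fun _ : 'I_1 => X : lmodType R) ord0).
Qed.

(** [Hom(Z, -)] is left exact, and lifting maps from a summand [Z] of a power of
    [X] reduces to lifting maps from [X]. *)
Lemma F_exactI (U V T : lmodType R) (f : hom U V) (g : hom V T) : short_exact f g ->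
  (forall h : hom X T, exists s, homc g s = h) -> F_exact X f g.
Proof.
move=> [inj ker surj] lft; split=> // Z [n /direct_summandP[i [p pi]]]; split.
- move=> h h' e; apply: homP => x; apply: inj.
  exact: (congr1 (fun k : hom Z V => k x) e).
- move=> h; split=> [gh|[h' <-]]; last first.
    by apply: homP => x; apply/ker; exists (h' x).
  have [|h' fh] := factor_mono (h := h) inj; last by exists h'.
  by move=> x; apply/ker; rewrite -[LHS]homcE gh.
move=> h; pose P := fun _ : 'I_n => X : lmodType R.
have [s Hs] := choice (fun j => lft (homc (homc h p) (incl P j))).
exists (homc (\sum_j homc (s j) (proj P j)) i).
rewrite homcA homc_sumr -[RHS]homc1 -pi homcA; congr homc.
rewrite -[RHS]homc1 -[hom1 _]sum_incl_proj homc_sumr.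
by apply: eq_bigr => j _; rewrite homcA Hs homcA.
Qed.

Lemma F_exact_lift (U V T : lmodType R) (f : hom U V) (g : hom V T) :
  F_exact X f g -> forall h : hom X T, exists s, homc g s = h.
Proof. by case=> _ /(_ X add_X)[_ _]. Qed.

Lemma F_epi_exact M N (g : hom M N) : (forall h : hom X N, exists s, homc g s = h) ->
  exists (K : fgmod R) (f : hom K M), F_exact X f g.
Proof.
move=> lft; have [K [i [inj ker]]] := ker_fg ksR g.
by exists K, i; apply: F_exactI => //; split=> //; apply: lift_surj.
Qed.

Lemma F_exact_H (U V T : lmodType R) (f : hom U V) (g : hom V T) :
  F_exact X f g -> short_exact (Hmap f) (Hmap g).
Proof. by case=> _ /(_ X add_X)[]. Qed.

Lemma retract_F_exact M N (i : hom M N) (p : hom N M) : homc p i = hom1 M ->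
  exists (K : fgmod R) (f : hom K N), F_exact X f p.
Proof. by move=> pi; apply: F_epi_exact => h; exists (homc i h); rewrite homcA pi hom1c. Qed.

(** Maps out of [H M] come from maps out of [M], and a map is an F-epimorphism
    when its image under [H] is onto. *)
Lemma genF_gen M Z : genF X M Z <-> gen (H M) (Hfg Z).
Proof.
split=> [[n [K [f [g /F_exact_lift lft]]]]|/genP[n [g Hg]]].
  pose P := fun _ : 'I_n => M : lmodType R.
  apply: (@gen_maps _ (H M) (Hfg Z) _ (fun i : 'I_n => Hmap (homc g (incl P i)))) => h.
  have [s <-] := lft h; exists (fun i => homc (proj P i) s).
  rewrite -[s in LHS]hom1c -[hom1 _]sum_incl_proj homc_suml homc_sumr.
  by apply: eq_bigr => i _; rewrite HmapE !homcA.
have [u Hu] := choice (fun i => H_full (g i)).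
pose P := fun _ : 'I_n => M : lmodType R.
have [|K [f Ff]] := @F_epi_exact (fpower n M) Z (\sum_i homc (u i) (proj P i)).
  move=> h; have [x ->] := Hg h.
  exists (\sum_i homc (incl P i) (x i)); rewrite homc_sumr; apply: eq_bigr => i _.
  rewrite homc_suml (bigD1 i) //= big1 => [|j ji].
    by rewrite addr0 -homcA (homcA (proj _ _)) proj_incl hom1c Hu.
  by rewrite -homcA (homcA (proj _ _)) proj_incl_neq ?hom0c ?homc0 // eq_sym.
by exists n, K, f, (\sum_i homc (u i) (proj P i)).
Qed.

Lemma F_projective_summand P : F_projective X P -> exists n, direct_summand P (power n X).
Proof.
move=> projP; have [n [g Hg]] := universal_map ksR X P.
have [K [f Ff]] := @F_epi_exact (fpower n X) P g Hg.
have [_ _ /(_ (hom1 P))[s gs]] := projP K (fpower n X) P f g Ff.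
by exists n; apply/direct_summandP; exists s, g.
Qed.

(** [H X] is the regular module, so [H P] is a summand of a free module. *)
Lemma H_projective (P : fgmod R) (B C : lmodType Gam) (g : hom B C) (t : hom (H P) C) :
  F_projective X P -> (forall y, exists x, g x = y) -> exists t', homc g t' = t.
Proof.
move=> /F_projective_summand[n /direct_summandP[i [p pi]]] surj.
pose Q := fun _ : 'I_n => X : lmodType R.
pose e j : H P := homc p (incl Q j).
have [b Hb] := choice (fun j => surj (t (e j))).
pose t' (h : H P) : B := \sum_j (homc (proj Q j) (homc i h) : Gam) *: b j.
have lt' : linear t'.
  move=> a h h'; rewrite /t' scaler_sumr -big_split; apply: eq_bigr => j _ /=.
  by rewrite scalerA -scalerDl Hscale !homcDr !homcA.
exists (linhom lt'); apply: homP => h.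
change (g (t' h) = t h); rewrite hom_sum.
under eq_bigr do rewrite hom_Z Hb -hom_Z.
rewrite -hom_sum; congr (t _).
rewrite -[RHS]hom1c -pi -homcA -[homc i h in RHS]hom1c -[hom1 (power n X)]sum_incl_proj.
rewrite homc_suml homc_sumr.
by apply: eq_bigr => j _; rewrite Hscale /e !homcA.
Qed.

Section Rigid.
Variables (W : fgmod R) (r : resolution X W).

Let cov : hom (res_obj r 0) W := res_cov r 0.

(** Surjectivity of [Hom(P0, W) -> Hom(P1, W)]; it is a reformulation of being
    presilting, see [presilting_rigid]. *)
Definition rigid : Prop := forall h : hom (res_obj r 1) W,
  exists h' : hom (res_obj r 0) W, h = homc h' (res_d r 0).

Lemma Hres_surj : forall y, exists x, Hmap cov x = y.
Proof. by case: (F_exact_H (res_exact r 0)). Qed.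

Lemma Hres_ker (h : hom X (res_obj r 0)) :
  homc cov h = 0 -> exists h', h = homc (res_d r 0) h'.
Proof.
case: (F_exact_H (res_exact r 0)) => _ /(_ h)[+ _] _ h0 => /(_ h0)[h1 <-].
case: (F_exact_H (res_exact r 1)) => _ _ /(_ h1)[h2 <-].
by exists h2; rewrite !HmapE homcA.
Qed.

Lemma res_dd : homc cov (res_d r 0) = 0.
Proof.
rewrite homcA; case: (res_exact r 0) => -[_ ker _] _.
have -> : homc cov (res_inc r 0) = 0.
  by apply: homP => x; apply/ker; exists x.
exact: hom0c.
Qed.

(** [H P1 -> H P0 -> H W -> 0] is a projective presentation. A lift to [B] over
    [H P0] restricts on [H P1] to a map into [G]. Since [G] is a quotient of a
    power of [H W], rigidity extends this map to [H P0], and subtracting the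
    extension makes the lift descend to [H W]. *)
Lemma rigid_lift (G : fgmod Gam) (B C : lmodType Gam) (f : hom G B) (g : hom B C)
    (t : hom (H W) C) : rigid -> short_exact f g -> gen (H W) G ->
  exists t', homc g t' = t.
Proof.
move=> rW [inj ker surj] /genP[n [q Hq]].
have [l gl] := H_projective (homc t (Hmap cov)) (res_proj r 0) surj.
have [|m fm] := factor_mono (i := f) (h := homc l (Hmap (res_d r 0))) inj.
  move=> x; apply/ker; rewrite -[g _]homcE homcA gl -homcA -Hmapc res_dd Hmap0 homcE hom0E.
  exact: hom_0.
pose HW := fun _ : 'I_n => H W.
pose qq : hom (dsum HW) G := \sum_i homc (q i) (proj HW i).
have surjq y : exists x, qq x = y.
  have [x ->] := Hq y; exists ([ffun i => x i] : dsum HW).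
  by rewrite hom_sumE; apply: eq_bigr => i _; rewrite homcE linhomE ffunE.
have [m1 Hm1] := H_projective m (res_proj r 1) surjq.
have ext i : exists k : hom (H (res_obj r 0)) (H W),
    homc (proj HW i) m1 = homc k (Hmap (res_d r 0)).
  have [u ->] := H_full (homc (proj HW i) m1).
  by have [v ->] := rW u; exists (Hmap v); rewrite Hmapc.
have [k Hk] := choice ext.
pose m' : hom (H (res_obj r 0)) G := \sum_i homc (q i) (k i).
have m'd : homc m' (Hmap (res_d r 0)) = m.
  rewrite -Hm1 !homc_suml; apply: eq_bigr => i _.
  by rewrite -!homcA Hk.
have [|t' Ht'] := factor_epi (h := l - homc f m') Hres_surj.
  move=> h /Hres_ker[h' ->].
  change (l (Hmap (res_d r 0) h') - f (homc m' (Hmap (res_d r 0)) h') = 0).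
  by rewrite m'd -[f (m h')]homcE fm subrr.
exists t'; apply: homP => y; have [x <-] := Hres_surj y.
rewrite -[LHS]homcE -homcA Ht' homcBr gl homcA.
have -> : homc g f = 0 by apply: homP => z; apply/ker; exists z.
by rewrite hom0c subr0.
Qed.

Lemma rigid_F_lift A B C (f : hom A B) (g : hom B C) (u : hom W C) :
  rigid -> F_exact X f g -> genF X W A -> exists u', homc g u' = u.
Proof.
move=> rW /F_exact_H eH /genF_gen gA.
have [t' Ht'] := @rigid_lift (Hfg A) (H B) (H C) _ _ (Hmap u) rW eH gA.
have [v tv] := H_full t'; exists v; apply: H_faithful => h.
by rewrite -!HmapE Hmapc -tv Ht'.
Qed.

End Rigid.
End Dictionary.

(** * Presilting modules, relative extensions and torsion classes *)

Section Presilting.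
Variables (R : pzRingType) (P1 P0 : lmodType R) (p : hom P1 P0).

Lemma two_term_zero (i : int) : i != 0 -> i != -1 -> is_zero (two_term_obj P1 P0 i).
Proof.
by case: i => [[|n]|[|n]] //= _ _ x; apply/rowP => -[].
Qed.

(** For shifts by two or more, source and target of a chain map are never both
    nonzero. *)
Lemma two_term_shift_eq0 (i : int) : 1 < i ->
  homK_eq0 (two_term p) (shift (two_term p) i).
Proof.
move=> i1 f _; exists (fun _ _ => 0) => j; rewrite homc0 hom0c addr0.
apply: homP => x; rewrite hom0E.
have [jz|jn0] := eqVneq j 0.
  by apply: two_term_zero; rewrite jz add0r gt_eqF // (lt_trans _ i1).
have [jz|jn1] := eqVneq j (-1).
  apply: two_term_zero; first by rewrite jz addrC subr_eq0 gt_eqF.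
  by rewrite jz addrC gt_eqF // (@lt_trans _ _ 0) ?subr_gt0.
have x0 : x = 0 by apply: two_term_zero.
by rewrite x0 hom_0.
Qed.

(** The chain map given by [g] in degree -1: in that degree the shifted complex
    is [P0]. *)
Definition shift1_map (g : hom P1 P0) (j : int) :
    hom (two_term p j) (shift (two_term p) 1 j) :=
  match j return hom (two_term p j) (shift (two_term p) 1 j) with
  | Negz 0 => g
  | _ => 0
  end.

Lemma two_term_shift1 : homK_eq0 (two_term p) (shift (two_term p) 1) <->
  forall g : hom P1 P0, exists (a : hom P0 P0) (b : hom P1 P1),
    g = homc a p + homc p b.
Proof.
split=> [hK g|hg f fm].
  have [|s Hs] := hK (shift1_map g).
    move=> i j.
    case: i => [[|i]|[|i]]; case: j => [[|j]|[|j]];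
      rewrite /= ?homc0 ?hom0c //; apply: homP => x //=; rewrite ?hom_0 //.
  exists (s 0 (-1)), (- s (-1) (-2)).
  have := Hs (-1) => /= ->; rewrite addrC; congr (_ + _).
  apply: homP => x; change (- p (s (-1) (-2) x) = p (- s (-1) (-2) x)).
  by rewrite hom_N.
have [a [b ab]] := hg (f (-1)).
exists (fun i j => match i, j
    return hom (two_term p i) (shift (two_term p) 1 j) with
  | Posz 0, Negz 0 => a
  | Negz 0, Negz 1 => - b
  | _, _ => 0
  end) => i.
have [->|in1] := eqVneq i (-1).
  rewrite [LHS]ab addrC; congr (_ + _).
  by apply: homP => x; change (p (b x) = - p (- b x)); rewrite hom_N opprK.
apply: homP => x.
have [i0|in0] := eqVneq i 0; last first.
  have x0 : x = 0 by apply: two_term_zero.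
  by rewrite x0 !hom_0.
have z : is_zero (shift (two_term p) 1 i) by move: (i0) => ->; apply: two_term_zero.
by rewrite (z (f i x)) [RHS]z.
Qed.

End Presilting.

Section Lifting.
Variables (R : pzRingType) (X : fgmod R).
Hypotheses (ksR : krull_schmidt_ring R) (hX : additive_generator X).
Implicit Types (A B C M N W Z : fgmod R) (U V : lmodType R).

(** Maps from the projective [P1] to [M] lift to [P0], and maps from [P0] to [M]
    come from endomorphisms of [P0]. Hence extending [h : P1 -> M] along the
    differential amounts to a homotopy for its lift [g : P1 -> P0], where the
    second half of the homotopy accounts for the choice of the lift. *)
Lemma presilting_rigid (res : forall M, min_resolution X M) M :
  F_presilting res M <-> rigid (res M).
Proof.
set r := res M; set d := res_d r 0.
have [[incinj exinc _] _] := res_exact r 0.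
have covd : homc (res_cov r 0) d = 0 := res_dd r.
pose cov : hom (res_obj r 0) M := res_cov r 0.
have covP (P : fgmod R) (t : hom P M) : F_projective X P ->
    exists t' : hom P (res_obj r 0), homc cov t' = t.
  by move=> /(_ _ _ _ _ _ (res_exact r 0))[_ _ /(_ t)].
split=> [pre h|rig P i].
  have /two_term_shift1 hg := pre 1 ltr01.
  have [g covg] := covP _ h (res_proj r 1).
  have [a [b gab]] := hg g; exists (homc cov a).
  by rewrite -covg gab homcDr [homc cov (homc d b)]homcA covd hom0c addr0 homcA.
rewrite {}/P gtz0_ge1 le_eqVlt => /orP[/eqP <-|]; last exact: two_term_shift_eq0.
apply/two_term_shift1 => g.
have [h Hh] := rig (homc cov g).
have [a cova] := covP _ h (res_proj r 0).
have [|u Hu] := factor_mono (i := res_inc r 0) (h := g - homc a d) incinj.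
  move=> x; apply/exinc; have := congr1 (fun k : hom _ _ => k x) (homcBr cov g (homc a d)).
  by rewrite homcE => ->; rewrite homBE homcA cova -Hh subrr.
have [_ _ /(_ u)[b Hb]] := res_proj r 1 (res_exact r 1).
by exists a, b; rewrite /d /res_d -homcA Hb Hu addrC subrK.
Qed.

Definition F_ext_vanishes (W Z : fgmod R) : Prop :=
  forall (B : fgmod R) (f : hom Z B) (g : hom B W), F_exact X f g ->
    exists s, homc g s = hom1 W.

(** Equivalent to the vanishing of the relative extension group, but visibly
    inherited by sums and summands of [U]. *)
Definition F_lifts (U : lmodType R) Z : Prop :=
  forall (B C : fgmod R) (f : hom Z B) (g : hom B C), F_exact X f g ->
    forall u : hom U C, exists u', homc g u' = u.

(** The pullback of the sequence along [u] splits. *)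
Lemma ext_vanishes_lifts W Z : F_ext_vanishes W Z -> F_lifts W Z.
Proof.
move=> ext B C f g Ffg u; have [[inj ker surj] _] := Ffg.
have [|K [i [iinj im]]] := @sub_fg _ ksR (fpair B W) (fun x => g x.1 = u x.2).
  by split=> [|a x y gx gy] /=; rewrite ?hom_0 // !hom_P gx gy.
pose q : hom K W := homc (psnd B W) i.
have [|k Hk] := factor_mono (i := i) (h := homc (pinl B W) f) iinj.
  move=> z; apply/im; change (g (f z) = u 0); rewrite hom_0.
  by apply/ker; exists z.
have ik z : i (k z) = (f z, 0) by rewrite -[LHS]homcE Hk.
have [|s Hs] := ext K k q.
  apply: F_exactI.
    split=> [z z' e|x|w].
    + by apply: inj; have := congr1 (fun y => (i y).1) e; rewrite !ik.
    + split=> [qx|[z <-]]; last by change ((i (k z)).2 = 0); rewrite ik.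
      have gix : g (i x).1 = u (i x).2 by apply/im; exists x.
      have ix2 : (i x).2 = 0 by exact: qx.
      have : g (i x).1 = 0 by rewrite gix ix2 hom_0.
      case/ker => z fz; exists z; apply: iinj.
      by rewrite ik fz -ix2 -surjective_pairing.
    + have [b gb] := surj (u w).
      have [y iy] : exists y, i y = (b, w) by apply/im.
      by exists y; change ((i y).2 = w); rewrite iy.
  move=> h; have [b gb] := F_exact_lift Ffg (homc u h).
  have [|y iy] := factor_mono (i := i) (h := homc (pinl B W) b + homc (pinr B W) h) iinj.
    move=> x; apply/im.
    change (g (b x + 0) = u (0 + h x)); rewrite addr0 add0r.
    by rewrite -[LHS]homcE gb.
  exists y; rewrite /q -homcA iy homcDr !homcA psnd_inl psnd_inr.
  by rewrite hom0c hom1c add0r.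
exists (homc (homc (pfst B W) i) s); apply: homP => w.
have : g (i (s w)).1 = u (i (s w)).2 by apply/im; exists (s w).
have -> : (i (s w)).2 = w by rewrite -[RHS]hom1E -Hs.
by [].
Qed.

(** A map [h] from [P1] that vanishes on [P2] factors through the first syzygy.
    The pushout of the sequence [0 -> syz -> P0 -> W -> 0] along it splits, and a
    retraction extends [h] to [P0]. *)
Lemma ext_vanishes_ext1F W Z (r : resolution X W) : F_ext_vanishes W Z -> ext1F_eq0 r Z.
Proof.
move=> ext h hd.
have [[incinj exinc covsurj] _] := res_exact r 0.
have [[_ excov1 cov1surj] _] := res_exact r 1.
have [h' Hh'] : exists h' : hom (res_syz r 0) Z, homc h' (res_cov r 1) = h.
  apply: factor_epi => // x /excov1[y <-].
  have [[_ _ cov2surj] _] := res_exact r 2.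
  have [z <-] := cov2surj y.
  exact: (congr1 (fun k : hom _ _ => k z) hd).
pose inc : hom (res_syz r 0) (res_obj r 0) := res_inc r 0.
pose cov : hom (res_obj r 0) W := res_cov r 0.
have covinc x : cov (inc x) = 0 by apply/exinc; exists x.
pose D := fpair Z (res_obj r 0).
have [|B [p [psurj pker]]] :=
    @quot_fg _ D (fun x : D => exists s, x = (h' s, - inc s)).
  split=> [|a _ _ [s ->] [t ->]]; first by exists 0; rewrite (hom_0 h') (hom_0 inc) oppr0.
  exists (a *: s + t); rewrite (hom_P h') (hom_P inc) opprD -scalerN.
  by [].
pose f : hom Z B := homc p (pinl Z (res_obj r 0)).
have [|g Hg] := factor_epi (p := p) (h := homc cov (psnd Z (res_obj r 0))) psurj.
  move=> x /pker[s ->]; change (cov (- inc s) = 0).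
  by rewrite hom_N covinc oppr0.
have gp z y : g (p (z, y)) = cov y.
  exact: (congr1 (fun k : hom _ _ => k (z, y)) Hg).
have Ffg : F_exact X f g.
  apply: F_exactI.
    split=> [z z' e|b|w].
    - have : p (z - z', 0) = 0.
        have -> : (z - z', 0) = (z, 0) - (z', 0) :> D by congr pair; rewrite /= subr0.
        by rewrite hom_B; apply/eqP; rewrite subr_eq0; apply/eqP.
      case/pker => s [e1 e2]; apply/eqP; rewrite -subr_eq0 e1.
      have -> : s = 0; last by rewrite hom_0.
      by apply: incinj; rewrite hom_0; apply/eqP; rewrite -oppr_eq0 -e2.
    - have [[z y] <-] := psurj b; rewrite gp; split=> [cy|[z' e]].
        have [s <-] : exists s, inc s = y by apply/exinc.
        exists (z + h' s); change (p (z + h' s, 0) = p (z, inc s)).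
        apply/eqP; rewrite -subr_eq0 -hom_B; apply/eqP/pker; exists s.
        by congr pair; rewrite /= ?sub0r // addrAC subrr add0r.
      by rewrite -(gp z y) -e; change (g (p (z', 0)) = 0); rewrite gp hom_0.
    - by have [y <-] := covsurj w; exists (p (0, y)); rewrite gp.
  move=> k; have [y <-] := F_exact_lift (res_exact r 0) k.
  exists (homc (homc p (pinr Z (res_obj r 0))) y).
  by apply: homP => x; change (g (p (0, y x)) = cov (y x)); rewrite gp.
have [s gs] := ext B f g Ffg.
have [[finj kerg _] _] := Ffg.
have [|q Hq] := factor_mono (i := f) (h := hom1 B - homc s g) finj.
  by move=> b; apply/kerg; rewrite homBE hom_B homcE -[g (s _)]homcE gs !hom1E subrr.
exists (homc q (homc p (pinr Z (res_obj r 0)))).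
have qf z : q (f z) = z.
  apply: finj; rewrite -[f (q _)]homcE Hq homBE hom1E homcE.
  have -> : g (f z) = 0 by apply/kerg; exists z.
  by rewrite hom_0 subr0.
rewrite -Hh'; apply: homP => x; change (h' (res_cov r 1 x) = q (p (0, inc (res_cov r 1 x)))).
set t := res_cov r 1 x; rewrite -[LHS]qf; congr (q _).
change (p (h' t, 0) = p (0, inc t)).
apply/eqP; rewrite -subr_eq0 -hom_B; apply/eqP/pker; exists t.
by congr pair; rewrite /= ?sub0r ?subr0.
Qed.

Lemma lifts_ext_vanishes W Z : F_lifts W Z -> F_ext_vanishes W Z.
Proof. by move=> lft B f g Ffg; apply: lft Ffg _. Qed.

Lemma lifts_id_factors U (I : finType) (V : I -> lmodType R) Z :
  id_factors U V -> (forall i, F_lifts (V i) Z) -> F_lifts U Z.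
Proof.
move=> [a [b ab]] lft B C f g Ffg u.
pose s i := cid (lft i B C f g Ffg (homc u (a i))).
exists (\sum_i homc (sval (s i)) (b i)); rewrite homc_sumr -[RHS]homc1 -ab homc_sumr.
by apply: eq_bigr => i _; rewrite !homcA (svalP (s i)).
Qed.

Lemma lifts_summand U V Z : direct_summand U V -> F_lifts V Z -> F_lifts U Z.
Proof.
case/direct_summandP=> i [p pi] lft B C f g Ffg u.
have [s Hs] := lft B C f g Ffg (homc u p).
by exists (homc s i); rewrite homcA Hs -homcA pi homc1.
Qed.

Section Torsion.
Variables (T : mclass R) (M0 : fgmod R).
Hypotheses (torT : F_torsion X T) (TM0 : T M0).

Lemma torsion_summand M N : direct_summand N M -> T M -> T N.
Proof.
case/direct_summandP=> i [p pi] TM.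
have [K [f Ff]] := retract_F_exact ksR hX pi.
exact: (torT.2 _ _ _ _ _ Ff).
Qed.

Lemma torsion_pair M N : T M -> T N -> T (fpair M N).
Proof.
have Ff : F_exact X (pinl M N) (psnd M N).
  apply: F_exactI => [|h]; last first.
    by exists (homc (pinr M N) h); rewrite homcA psnd_inr hom1c.
  split=> [x y [] //|[x y]|y]; last by exists (0, y).
  by split=> [e|[z [_ <-]] //]; exists x; congr pair.
exact: (torT.1 M (fpair M N) N _ _ Ff).
Qed.

(** Instead of following the decomposition of [Z], one builds a module [Y] in [T]
    from pairs and maps it to [Z] in such a way that the identity of [Z] factors. *)
Lemma torsion_id_factors Z (I : finType) (V : I -> fgmod R) :
  (forall i, T (V i)) -> id_factors Z (fun i => V i : lmodType R) -> T Z.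
Proof.
move=> TV [a [b ab]].
have cover (s : seq I) : exists (Y : fgmod R) (y : hom Y Z), T Y /\
    forall i, i \in s -> exists w, homc y w = a i.
  elim: s => [|j s [Y [y [TY Hy]]]]; first by exists M0, 0; split.
  exists (fpair Y (V j)), (homc y (pfst Y (V j)) + homc (a j) (psnd Y (V j))).
  split; first exact: torsion_pair.
  move=> i; rewrite in_cons => /orP[/eqP->|/Hy[w <-]].
    exists (pinr Y (V j)).
    by rewrite homcDl -!homcA pfst_inr psnd_inr homc0 homc1 add0r.
  exists (homc (pinl Y (V j)) w).
  by rewrite homcDl -!homcA !(homcA _ (pinl _ _)) pfst_inl psnd_inl hom0c homc0 hom1c addr0.
have [Y [y [TY Hy]]] := cover (enum I).
have Hy' i : exists w, homc y w = a i by apply: Hy; rewrite mem_enum.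
pose w i := cid (Hy' i).
apply: torsion_summand TY; apply/direct_summandP.
exists (\sum_i homc (sval (w i)) (b i)), y.
by rewrite homc_sumr -ab; apply: eq_bigr => i _; rewrite homcA (svalP (w i)).
Qed.

End Torsion.
End Lifting.

(** * Finiteness of the Ext-projectives of gen(H) *)

Section GenMore.
Variable R : pzRingType.
Implicit Types (U : lmodType R) (M : fgmod R).

Lemma gen_extension (N : lmodType R) (A B C : fgmod R) (f : hom A B) (g : hom B C) :
  short_exact f g -> (forall t : hom N C, exists t', homc g t' = t) ->
  gen N A -> gen N C -> gen N B.
Proof.
move=> [_ ker _] lft /genP[n [u Hu]] /genP[m [v Hv]].
have [v' Hv'] := choice (fun i => lft (v i)).
apply: (@gen_maps _ N B ('I_n + 'I_m)%type (fun j => match j with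
  | inl i => homc f (u i) | inr i => v' i end)) => y.
have [z Hz] := Hv (g y).
have : g (y - \sum_i v' i (z i)) = 0.
  rewrite hom_B hom_sum Hz; apply/eqP; rewrite subr_eq0; apply/eqP.
  by apply: eq_bigr => i _; rewrite -Hv'.
case/ker => a fa; have [x Hx] := Hu a.
exists (fun j => match j with inl i => x i | inr i => z i end).
rewrite big_sumType /= -(hom_sum f) -Hx fa subrK //.
Qed.

Lemma gen_id_factors (N : lmodType R) M (I : finType) (V : I -> lmodType R) :
  id_factors M V -> (forall i, direct_summand (V i) N) -> gen N M.
Proof.
move=> [a [b ab]] sV.
have c i : {u : hom (V i) N & {v : hom N (V i) | homc v u = hom1 (V i)}}.
  have [u Hu] := cid ((direct_summandP _ _).1 (sV i)); exists u.
  exact: cid.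
apply: (gen_maps (g := fun i => homc (a i) (sval (projT2 (c i))))) => y.
exists (fun i => projT1 (c i) (b i y)).
rewrite -[LHS]hom1E -ab hom_sumE; apply: eq_bigr => i _.
change (a i (b i y) = a i (homc (sval (projT2 (c i))) (projT1 (c i)) (b i y))).
by rewrite (svalP (projT2 (c i))).
Qed.

Lemma id_factors_pair U (I : finType) (V : I -> lmodType R) (W : lmodType R) :
  id_factors U V -> id_factors (U * W)%type
    (fun j : I + unit => match j with inl i => V i | inr _ => W end).
Proof.
move=> [a [b ab]].
exists (fun j => match j return hom (match j with inl i => V i | inr _ => W end) (U * W)%type
  with inl i => homc (pinl U W) (a i) | inr _ => pinr U W end).
exists (fun j => match j return hom (U * W)%type (match j with inl i => V i | inr _ => W end)
  with inl i => homc (b i) (pfst U W) | inr _ => psnd U W end).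
rewrite big_sumType /=.
under eq_bigr do rewrite -homcA (homcA (a _)).
rewrite -homc_sumr -homc_suml ab hom1c (big_pred1 tt); [exact: sum_pair|by case].
Qed.

Lemma id_factors_unit U : id_factors U (fun _ : unit => U).
Proof.
by exists (fun=> hom1 U), (fun=> hom1 U); rewrite (big_pred1 tt) ?homc1 //; case.
Qed.

Lemma ext1_iso (M N A : fgmod R) : isomorphic M N -> ext1_eq0 M A -> ext1_eq0 N A.
Proof.
case=> u /bij_inverse[v [vu uv]] ext B f g [inj ker surj].
have vK z : u (v z) = z by rewrite -[LHS]homcE uv.
have [|s gs] := ext B f (homc v g).
  split=> // [b|c].
    rewrite -ker homcE; split=> [vg|->]; last exact: hom_0.
    by rewrite -[g b]vK vg hom_0.
  have [b gb] := surj (u c); exists b.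
  by rewrite homcE gb -[LHS]homcE vu.
exists (homc s v); apply: homP => c; change (g (s (v c)) = c).
rewrite -[LHS]vK -[RHS]vK; congr (u _).
exact: (congr1 (fun k : hom _ _ => k (v c)) gs).
Qed.

Lemma summand_power1 U V : direct_summand U V -> direct_summand U (power 1 V).
Proof.
move=> /summand_trans; apply.
exact: (@dsum_summand _ _ (fun _ : 'I_1 => V : lmodType R) ord0).
Qed.

End GenMore.

Section ApproximationFinite.
Variables (G : pzRingType).
Hypothesis ksG : krull_schmidt_ring G.

(** Let [c : Hm -> C] be the quotient by the submodule of [e], and
    [E = Hm + C]. For an Ext-projective [N] choose [q : E ^ n -> N] through which
    all maps from [E] to [N] factor. It suffices that the kernel [K] of [q] is in
    [gen Hm], for then [q] splits. An element [x] of [K] is the value at [e] of a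
    map [h : Hm -> E ^ n]. As [q h] kills [e], it factors through [C], hence lifts
    along [q]; correcting [h] by the lift, which still kills [e], gives a map
    [Hm -> K] with value [x] at [e]. *)
Lemma ext_projective_bound (Hm : fgmod G) (e : Hm) :
  (forall x : Hm, exists h : hom Hm Hm, h e = x) ->
  exists E : fgmod G, forall N : fgmod G, gen Hm N ->
    (forall A, gen Hm A -> ext1_eq0 N A) -> exists n, direct_summand N (power n E).
Proof.
move=> appr.
have apprU (U : fgmod G) (u : U) : gen Hm U -> exists h : hom Hm U, h e = u.
  case/genP=> n [g Hg]; have [x ->] := Hg u.
  have [h Hh] := choice (fun i => appr (x i)).
  exists (\sum_i homc (g i) (h i)); rewrite hom_sumE.
  by apply: eq_bigr => i _; rewrite homcE Hh.
have [|C [c [csurj cker]]] := @quot_fg _ Hm (fun x => exists a, x = a *: e).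
  split=> [|a _ _ [b ->] [b' ->]]; first by exists 0; rewrite scale0r.
  by exists (a * b + b'); rewrite scalerDl scalerA.
pose E := fpair Hm C; exists E => N genN extN.
have [n [q Hq]] := universal_map ksG E N.
exists n.
have genE : gen Hm E.
  apply: (@gen_surj _ Hm (fpair Hm Hm) E
    (homc (pinl Hm C) (pfst Hm Hm) + homc (pinr Hm C) (homc c (psnd Hm Hm)))).
    move=> [x y]; have [z <-] := csurj y; exists (x, z).
    by rewrite homDE !homcE /=; congr pair => /=; rewrite ?addr0 ?add0r.
  apply: (@gen_id_factors _ Hm (fpair Hm Hm) _ _ (id_factors_pair Hm (id_factors_unit Hm))).
  by case=> _; apply: summand_refl.
have surj y : exists x, q x = y.
  have [m [g Hg]] := genP genN; have [x ->] := Hg y.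
  have [s Hs] := choice (fun i => Hq (homc (g i) (pfst Hm C))).
  exists (\sum_i s i (x i, 0)); rewrite hom_sum; apply: eq_bigr => i _.
  by rewrite -[LHS]homcE Hs.
have [K [i [inj ker]]] := ker_fg ksG q (M := fpower n E).
have hit (x : K) : exists h : hom Hm K, h e = x.
  have [h he] := apprU (fpower n E) (i x) (gen_power n genE).
  have [|t Ht] := factor_epi (p := c) (h := homc q h) csurj.
    move=> y /cker[a ->]; rewrite homcE hom_Z hom_Z he.
    by have -> : q (i x) = 0 by [apply/ker; exists x]; rewrite scaler0.
  have [s qs] := Hq (homc t (psnd Hm C)).
  have [|k Hk] := factor_mono (i := i) (h := h - homc s (homc (pinr Hm C) c)) inj.
    move=> y; apply/ker; rewrite homBE hom_B -homcE -Ht.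
    rewrite [q (homc s _ y)](_ : _ = homc (homc q s) (homc (pinr Hm C) c) y) //.
    by rewrite qs subrr.
  exists k; apply: inj; rewrite -[LHS]homcE Hk homBE he.
  change (i x - s (pinr Hm C (c e)) = i x).
  have -> : c e = 0 by apply/cker; exists 1; rewrite scale1r.
  by rewrite (hom_0 (pinr Hm C)) (hom_0 s) subr0.
have genK : gen Hm K.
  have [m [y Hy]] := fgmodP K; have [h Hh] := choice (fun i => hit (y i)).
  apply: (gen_maps (g := h)) => x; have [a ->] := Hy x.
  by exists (fun i => a i *: e); apply: eq_bigr => j _; rewrite hom_Z Hh.
have [|s qs] := extN K genK (fpower n E) i q; first by split.
by apply/direct_summandP; exists s, q.
Qed.

Lemma PP_exists (Hm : fgmod G) (e : Hm) :
  (forall x : Hm, exists h : hom Hm Hm, h e = x) -> exists P, is_PP (gen Hm) P.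
Proof.
move=> /ext_projective_bound[E HE].
pose Q (W : fgmod G) := [/\ gen Hm W, indecomposable W & forall A, gen Hm A -> ext1_eq0 W A].
have [I [V [indV sV facV]]] := fg_decomposable ksG E.
pose V' i := sval (cid (fg_summand (sV i))).
have VV' i : isomorphic (V i) (V' i) := svalP (cid (fg_summand (sV i))).
have [||||n [f [Qf neqf Qall]]] := @representatives (fgmod G)
  (fun A B => isomorphic A B) Q I V'.
- by move=> x; apply: iso_refl.
- by move=> x y; apply: iso_sym.
- by move=> x y z; apply: iso_trans.
- move=> x y xy [gx indx extx]; split.
  + by apply: gen_summand gx; apply: iso_summand; apply: iso_sym.
  + exact: indecomposable_iso indx.
  + by move=> A gA; apply: ext1_iso (extx A gA).
exists (dsum (fun i => V' (f i) : lmodType G)), n, (fun i => V' (f i)); split=> //.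
- move=> W QW; have [gW indW extW] := QW.
  have [m sW] := HE W gW extW.
  have [j Wj] := krull_schmidt ksG indW indV facV sW.
  have WV' := iso_trans Wj (VV' j).
  have [|i ji] := Qall j; last by exists i; apply: iso_trans ji.
  split.
  + by apply: gen_summand gW; apply: iso_summand; apply: iso_sym.
  + exact: indecomposable_iso indW.
  + by move=> A gA; apply: ext1_iso (extW A gA).
- exact: iso_refl.
Qed.

End ApproximationFinite.

(** * Special presilting modules and torsion classes *)

Section Main.
Variables (R : pzRingType) (X : fgmod R).
Hypotheses (ksR : krull_schmidt_ring R) (ksG : krull_schmidt_ring (endo X)^c).
Hypothesis hX : additive_generator X.
Variable res : forall M : fgmod R, min_resolution X M.
Hypothesis hF : F_admissible res.
Implicit Types (M N W Z : fgmod R) (T : mclass R).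

Local Notation Gam := ((endo X)^c).
Local Notation H U := (hom X U : lmodType Gam).
Local Notation Hf := (Hfg X ksR).

(** Vanishing of [Ext^1_F(W, W)] makes every map [P1 -> W] that kills [P2] extend
    to [P0]; by admissibility all maps [P1 -> W] kill [P2]. *)
Lemma lifts_rigid W : F_lifts X W W -> rigid (res W).
Proof.
move=> lft; have ext := ext_vanishes_ext1F (r := res W) (lifts_ext_vanishes lft).
by move=> h; apply: (ext); apply: hF.
Qed.

Lemma rigid_F_lifts W Z : rigid (res W) -> genF X W Z -> F_lifts X W Z.
Proof.
move=> rW gZ B C f g Ffg u; exact: (rigid_F_lift ksR hX u rW Ffg gZ).
Qed.

Lemma genF_torsion M : rigid (res M) -> F_torsion X (genF X M).
Proof.
move=> rM; split=> A B C f g Ffg; have eH := F_exact_H Ffg.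
  move=> /(genF_gen ksR hX) gA /(genF_gen ksR hX) gC; apply/(genF_gen ksR hX).
  apply: (@gen_extension _ (H M) (Hf A) (Hf B) (Hf C) _ _ eH _ gA gC) => t.
  exact: (@rigid_lift _ X ksR hX M _ (Hf A) (H B) (H C) _ _ t rM eH gA).
move=> /(genF_gen ksR hX) gB; apply/(genF_gen ksR hX).
by apply: (@gen_surj _ (H M) (Hf B) (Hf C) (Hmap X g) _ gB); case: eH.
Qed.

Lemma genF_refl M : genF X M M.
Proof. by apply/(genF_gen ksR hX); apply: (gen_refl (Hf M)). Qed.

Lemma rigid_ext1 W N : rigid (res W) -> direct_summand N W ->
  forall A, gen (H W) A -> ext1_eq0 (Hf N) A.
Proof.
move=> rW /direct_summandP[i [p pi]] A gA B f g efg.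
have [t' Ht'] := @rigid_lift _ X ksR hX W _ A B (H N) f g (Hmap X p) rW efg gA.
by exists (homc t' (Hmap X i)); rewrite homcA Ht' -Hmapc pi Hmap1.
Qed.

Lemma lifts_pair (U W Z : fgmod R) : F_lifts X U Z -> F_lifts X W Z -> F_lifts X (fpair U W) Z.
Proof.
move=> lU lW; apply: (lifts_id_factors (id_factors_pair W (id_factors_unit U))).
by case.
Qed.

(** [W + M] has no self-extensions, so it is rigid, and [rigid_lift] applies to
    it in place of [M]. *)
Lemma lifts_ext1 M W : rigid (res M) -> genF X M W ->
  (forall Z, genF X M Z -> F_lifts X W Z) ->
  forall A, gen (H M) A -> ext1_eq0 (Hf W) A.
Proof.
move=> rM gW lW A gA; pose Y := fpair W M.
have tM := genF_torsion rM.
have gY : genF X M Y by apply: (torsion_pair tM gW (genF_refl M)).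
have rY : rigid (res Y).
  by apply: lifts_rigid; apply: lifts_pair; [apply: lW|apply: rigid_F_lifts].
apply: (rigid_ext1 rY); first exact: fst_summand.
apply: (@gen_trans _ (H Y) (Hf M) A _ gA).
apply: (@gen_summand _ (H Y) (Hf Y)); last exact: (gen_refl (Hf Y)).
exact/H_summand/snd_summand.
Qed.

Lemma ext1_lifts W Z : ext1_eq0 (Hf W) (Hf Z) -> F_lifts X W Z.
Proof.
move=> ext; apply: (ext_vanishes_lifts ksR) => B f g Ffg.
have [s gs] := ext (Hf B) (Hmap X f) (Hmap X g) (F_exact_H Ffg).
have [u su] := H_full ksR hX s; exists u; apply: (H_faithful hX) => h.
by rewrite -HmapE Hmapc -su gs hom1c.
Qed.

(** An indecomposable summand of [Z] is isomorphic to [W]. *)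
Lemma add_disjoint M W : indecomposable W -> ~ add M W ->
  forall Z, add M Z -> add W Z -> is_zero Z.
Proof.
move=> indW nadd Z [n sZM] [m sZW]; apply: contrapT => nz; apply: nadd.
have [Z' indZ' sZ'] := indecomposable_summand ksR nz.
have [_ Z'W] := krull_schmidt ksR indZ' (fun _ => indW) (id_factors_unit W)
  (summand_trans sZ' sZW).
exists n; apply: summand_trans sZM; apply: summand_trans sZ'.
exact/iso_summand/iso_sym.
Qed.

(** Otherwise [M + W] would violate the maximality of [M]: the indecomposable
    summands of [M] together with [W] give pairwise non-isomorphic
    Ext-projectives of [gen (H M)], hence distinct summands of [P]. *)
Lemma special_contains M W : special_F_presilting res M -> indecomposable W ->
  genF X M W -> (forall Z, genF X M Z -> F_lifts X W Z) -> add M W.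
Proof.
move=> [bM /(presilting_rigid res)rM [P [PP nosum]]] indW gW lW.
apply: contrapT => nadd.
apply: (nosum W indW.1); first exact: add_disjoint.
have [_ [m [U [indU neqU isoU]]]] := bM.
have sU i : direct_summand (U i) M.
  by apply: summand_trans (iso_summand (iso_sym isoU)); apply: dsum_summand.
pose U' i := sval (cid (fg_summand (sU i))).
have UU' i : isomorphic (U i) (U' i) := svalP (cid (fg_summand (sU i))).
have sU' i : direct_summand (U' i) M.
  exact: summand_trans (iso_summand (iso_sym (UU' i))) (sU i).
have [n [V [_ neqV Vall isoP]]] := PP.
pose UW (j : 'I_m + unit) : fgmod R := match j with inl i => U' i | inr _ => W end.
have place j : exists i, isomorphic (H (UW j)) (V i).
  apply: (Vall (Hf (UW j))); split.
  - case: j => [i|[]]; last exact/(genF_gen ksR hX).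
    apply: (@gen_summand _ (H M) (Hf M)); last exact: (gen_refl (Hf M)).
    exact/H_summand/sU'.
  - apply: (H_indecomposable ksR hX); case: j => [i|[]] //.
    exact: indecomposable_iso (UU' i) (indU i).
  - case: j => [i|[]]; first exact: (rigid_ext1 rM (sU' i)).
    exact: lifts_ext1.
have [s Hs] := choice place.
have notU i : ~ isomorphic (U' i) W.
  move=> iso; apply: nadd; exists 1%N; apply: summand_power1.
  by apply: summand_trans (sU' i); apply/iso_summand/iso_sym.
have injs : injective s.
  move=> j l e; have jl : isomorphic (UW j) (UW l).
    apply: (H_iso ksR hX); apply: iso_trans (Hs j) _; rewrite e.
    exact/iso_sym/Hs.
  case: j l jl {e} => [i|[]] [i'|[]] //= iso; last 2 first.
  - by case: (notU i).
  - by case: (notU i'); apply: iso_sym.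
  congr inl; apply/eqP; apply: contrapT => /negP/neqU; apply.
  exact: iso_trans (iso_trans (UU' i) iso) (iso_sym (UU' i')).
apply: (@summand_trans _ _ (dsum (fun i => V i : lmodType Gam))); last first.
  exact/iso_summand/iso_sym.
apply: (id_factors_dsum injs).
apply: (id_factors_iso (V := fun j => H (UW j))) => //.
apply: H_id_factors.
apply: id_factors_iso (id_factors_pair W (id_factors_iso UU'
  (id_factors_summand (iso_summand isoU) (dsum_id_factors U)))).
by case=> [i|[]]; apply: iso_refl.
Qed.

Lemma special_summand M N : special_F_presilting res M -> special_F_presilting res N ->
  genF X M = genF X N -> direct_summand M N.
Proof.
move=> spM spN eMN.
have [[_ [m [U [indU neqU isoU]]]] /(presilting_rigid res)rM _] := spM.
have [[_ [n [V [indV neqV isoV]]]] _ _] := spN.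
have place i : exists j, isomorphic (U i) (V j).
  have sU : direct_summand (U i) M.
    by apply: summand_trans (iso_summand (iso_sym isoU)); apply: dsum_summand.
  have [W UW] := fg_summand sU.
  have sW : direct_summand W M := summand_trans (iso_summand (iso_sym UW)) sU.
  have gW : genF X M W.
    apply: (torsion_summand ksR hX (genF_torsion rM) sW); exact: genF_refl.
  have [k sWN] : add N W.
    apply: special_contains => //; rewrite -?eMN //.
      exact: indecomposable_iso (indU i).
    move=> Z gZ; apply: (lifts_summand sW); exact: rigid_F_lifts.
  have [j Wj] := krull_schmidt ksR (indecomposable_iso UW (indU i)) indV
    (id_factors_summand (iso_summand isoV) (dsum_id_factors V)) sWN.
  by exists j; apply: iso_trans Wj.
have [s Hs] := choice place.
have injs : injective s.
  move=> i j e; apply/eqP; apply: contrapT => /negP/neqU; apply.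
  by apply: iso_trans (Hs i) _; rewrite e; apply/iso_sym/Hs.
apply: summand_trans (iso_summand (iso_sym isoV)).
apply: (id_factors_dsum injs); apply: (id_factors_iso Hs).
exact: id_factors_summand (iso_summand isoU) (dsum_id_factors U).
Qed.

(** Each of [M] and [N] contains all relative Ext-projective indecomposables of
    the common torsion class, among them the summands of the other. *)
Lemma special_unique M N : special_F_presilting res M -> special_F_presilting res N ->
  genF X M = genF X N -> isomorphic M N.
Proof.
move=> spM spN e; apply: summand_antisym; last 2 first.
- exact: special_summand.
- exact: special_summand.
exact: (ks_chain ksR (fgmodP M)).
Qed.

Section TorsionClass.
Variable T : mclass R.
Hypothesis torT : F_tor_preen X T.

(** The preenvelope [f : X -> T0] is cut down to a summand of [T0] that contains
    the image of [f] and is minimal among such summands. Fitting's lemma then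
    turns an endomorphism fixing the new approximation into an idempotent, which
    minimality forces to be the identity. *)
Lemma minimal_approximation : exists (M : fgmod R) (f : hom X M),
  [/\ T M, forall Z, T Z -> forall h : hom X Z, exists h', homc h' f = h &
    forall g : hom M M, homc g f = f -> bijective g].
Proof.
have [_ pre tor] := torT.
have [T0 [f [TT0 Hf0]]] := pre X.
pose D (S : T0 -> Prop) := exists e : hom T0 T0,
  [/\ homc e e = e, homc e f = f & forall x, S x <-> e x = x].
case: (@minimal_exists _ D (fun S' S => (forall x, S' x -> S x) /\ exists2 x, S x & ~ S' x)
  _ (fun=> True)).
- move=> u Du lt; have [||n Hn] := ks_chain ksR (fgmodP T0) (T := u).
  + move=> n; have [e [_ _ im]] := Du n; split; first by apply/im; rewrite hom_0.
    by move=> a x y /im ex /im ey; apply/im; rewrite hom_P ex ey.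
  + by right=> n; apply: (lt n).1.
  by case: (lt n) => _ [x ux []]; apply/(Hn n.+1).
- by exists (hom1 T0); split=> //; rewrite ?homc1 ?hom1c.
move=> S [e [ee ef im]] Smin.
have [A [i0 [p0 [pi0 ip0]]]] := idem_split ee.
have sA : direct_summand A T0 by apply/direct_summandP; exists i0, p0.
pose M : fgmod R := Fgmod (summand_fg sA (fgmodP T0)).
pose i : hom M T0 := i0; pose p : hom T0 M := p0.
have pi : homc p i = hom1 M := pi0; have ip : homc i p = e := ip0.
exists M, (homc p f); split.
- exact: (torsion_summand ksR hX (N := M) tor sA TT0).
- move=> Z TZ h; have [h' Hh'] := Hf0 Z TZ h; exists (homc h' i).
  by rewrite -homcA (homcA i) ip ef.
move=> g gf; have [e' [e'e' _ e'1 e'f]] := fitting g (ks_chain ksR (fgmodP M)).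
apply: e'1; have e'pf := e'f _ _ gf.
pose e2 := homc i (homc e' p).
have e2e2 : homc e2 e2 = e2.
  by rewrite /e2 -!homcA (homcA p) pi hom1c (homcA e') e'e'.
apply: contrapT => ne1; apply: (Smin (fun x => e2 x = x)).
  by exists e2; split=> //; rewrite /e2 -!homcA e'pf homcA ip ef.
have ee2 : homc e e2 = e2 by rewrite /e2 -ip -!homcA (homcA p) pi hom1c.
split=> [x ex|]; first by apply/im; rewrite -ex -[LHS]homcE ee2.
apply: contrapT => no; apply: ne1.
have e2e : e2 = e.
  apply: homP => x; apply: contrapT => ne; apply: no.
  exists (e x); first by apply/im; rewrite -[LHS]homcE ee.
  move=> e2ex; apply: ne; rewrite -e2ex /e2 -ip !homcE.
  by rewrite -[p (i _)]homcE pi.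
have pe2i : homc p (homc e2 i) = e' by rewrite /e2 -!homcA pi homc1 homcA pi hom1c.
by rewrite -pe2i e2e -ip -homcA pi homc1 pi.
Qed.

(** [M0] is the minimal left approximation of [X] in [T]; it generates [T] and is
    a relative Ext-projective of [T]. The wanted module [M] is the sum of all
    indecomposable relative Ext-projectives. There are finitely many, because the
    functor [H] sends them injectively to the Ext-projectives of [gen (H M0)];
    it is special because every summand [M'] excluded by the definition would
    contain one more of them. *)
Lemma torsion_class_special : exists M : fgmod R,
  [/\ special_F_presilting res M & genF X M = T].
Proof.
have [[Z0 TZ0 nzZ0] pre tor] := torT.
have [M0 [f0 [TM0 appr lmin]]] := minimal_approximation.
(* Wakamatsu's argument: the middle term of an extension of M0 by a module of T
   is in T, so a lift of f0 to it factors through f0 and splits the extension up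
   to an automorphism of M0 *)
have lift0 Z : T Z -> F_lifts X M0 Z.
  move=> TZ; apply: (ext_vanishes_lifts ksR) => B f g Ffg.
  have TB : T B := tor.1 _ _ _ _ _ Ffg TZ TM0.
  have [l gl] := F_exact_lift Ffg f0.
  have [s sf0] := appr B TB l.
  have gs : homc (homc g s) f0 = f0 by rewrite -homcA sf0.
  have [u [_ gsu]] := bij_inverse (lmin _ gs).
  by exists (homc s u); rewrite homcA.
(* an F-epimorphism from a power of X to a module of T factors through the
   corresponding power of M0 *)
have genT Z : T Z <-> genF X M0 Z.
  split=> [TZ|[n [K [f [g Ffg]]]]]; last first.
    apply: (tor.2 K (fpower n M0) Z f g Ffg).
    exact: (@torsion_id_factors _ X ksR hX T M0 tor TM0 (fpower n M0) _
      (fun=> M0) (fun=> TM0) (dsum_id_factors _)).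
  apply/(genF_gen ksR hX).
  have [n [p Hp]] := universal_map ksR X Z.
  pose P := fun _ : 'I_n => X : lmodType R.
  have [q Hq] := choice (fun i : 'I_n => appr Z TZ (homc p (incl P i))).
  apply: (@gen_maps _ (H M0) (Hf Z) _ (fun i => Hmap X (q i))) => h.
  have [s <-] := Hp h; exists (fun i => homc f0 (homc (proj P i) s)).
  rewrite -[s in LHS]hom1c -[hom1 _]sum_incl_proj homc_suml homc_sumr.
  by apply: eq_bigr => i _; rewrite HmapE !homcA Hq.
have rM0 : rigid (res M0) by apply: lifts_rigid; apply: lift0.
have [|P PP] := @PP_exists _ ksG (Hf M0) (f0 : H M0).
  move=> h; have [h' Hh'] := appr M0 TM0 h; exists (Hmap X h'); exact: Hh'.
pose Q W := [/\ T W, indecomposable W & forall Z, T Z -> F_lifts X W Z].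
have [n [V [extV neqV Vall isoP]]] := PP.
have QV W : Q W -> exists j, isomorphic (H W) (V j).
  move=> [TW indW lW]; apply: (Vall (Hf W)); split.
  - exact/(genF_gen ksR hX)/genT.
  - exact: H_indecomposable.
  - by apply: lifts_ext1 => //; [apply/genT|move=> Z /genT; apply: lW].
pose I := [set j : 'I_n | `[< exists2 W, Q W & isomorphic (H W) (V j) >]].
have pick (a : 'I_#|I|) : exists2 W, Q W & isomorphic (H W) (V (enum_val a)).
  by have := enum_valP a; rewrite inE => /asboolP.
pose W a : fgmod R := s2val (cid2 (pick a)).
have QW a : Q (W a) := s2valP (cid2 (pick a)).
have HW a : isomorphic (H (W a)) (V (enum_val a)) := s2valP' (cid2 (pick a)).
have Wall U : Q U -> exists a, isomorphic U (W a).
  move=> QU; have [j Uj] := QV U QU.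
  have jI : j \in I by rewrite inE; apply/asboolP; exists U.
  exists (enum_rank_in jI j); apply: (H_iso ksR hX); apply: iso_trans Uj _.
  by have := HW (enum_rank_in jI j); rewrite enum_rankK_in // => /iso_sym.
have fgM : finitely_generated (dsum (fun a => W a : lmodType R)).
  by apply: fg_dsum => a; apply: fgmodP.
pose M : fgmod R := Fgmod fgM.
have facM : id_factors M (fun a => W a : lmodType R) := dsum_id_factors _.
have sW a : direct_summand (W a) M := dsum_summand (fun a => W a : lmodType R) a.
have TM : T M.
  by apply: (torsion_id_factors ksR hX tor TM0 _ facM) => a; case: (QW a).
have rM : rigid (res M).
  apply: lifts_rigid; apply: (lifts_id_factors facM) => a.
  by case: (QW a) => _ _; apply.
have gMM0 : gen (H M) (Hf M0).
  have [J [U [indU sU facU]]] := fg_decomposable ksR M0.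
  have place j : exists a, isomorphic (U j) (W a).
    have [U' UU'] := fg_summand (sU j).
    have sU' : direct_summand U' M0 := summand_trans (iso_summand (iso_sym UU')) (sU j).
    have [|a U'W] := Wall U'; last by exists a; apply: iso_trans U'W.
    split; first exact: (torsion_summand ksR hX tor sU' TM0).
      exact: indecomposable_iso (indU j).
    by move=> Z TZ; apply: (lifts_summand sU'); apply: lift0.
  have [s Hs] := choice place.
  apply: (@gen_id_factors _ (H M) (Hf M0) _ (fun j => H (U j))).
    exact: H_id_factors facU.
  by move=> j; apply: H_summand; apply: summand_trans (iso_summand (Hs j)) (sW _).
have gM0M : gen (H M0) (Hf M) by apply/(genF_gen ksR hX)/genT.
(* so the modules P of M and of M0 are the same *)
have eqgen : gen (H M) = gen (H M0).
  apply/predeqP => A; split=> gA; first exact: (@gen_trans _ (H M0) (Hf M) A).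
  exact: (@gen_trans _ (H M) (Hf M0) A).
have eqT : genF X M = T.
  apply/predeqP => Z; split.
    by move=> /(genF_gen ksR hX); rewrite eqgen => /(genF_gen ksR hX)/genT.
  by move=> /genT /(genF_gen ksR hX); rewrite -eqgen => /(genF_gen ksR hX).
exists M; split=> //; split; last first.
- exists P; rewrite eqgen; split=> // M' nzM' disj sP.
  have [U indU sU] := indecomposable_summand ksR nzM'.
  have sHU : direct_summand (H U) P.
    apply: summand_trans sP; apply: H_summand.
    by apply: summand_trans sU _; apply: snd_summand.
  have [j Uj] := krull_schmidt ksG (W := Hf U) (H_indecomposable ksR hX indU)
    (fun j => (let: And3 _ ind _ := extV j in ind))
    (id_factors_summand (iso_summand isoP) (dsum_id_factors _)) (summand_power1 sHU).
  have [gVj _ extVj] := extV j.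
  have gU : genF X M0 U.
    apply/(genF_gen ksR hX).
    exact: (@gen_summand _ (H M0) (V j) (Hf U) (iso_summand Uj)).
  have [|a UW] := Wall U.
    split=> [|//|Z TZ]; first exact/genT.
    apply: ext1_lifts; apply: ext1_iso (iso_sym Uj) _; apply: extVj.
    exact/(genF_gen ksR hX)/genT.
  apply: indU.1; apply: disj.
    by exists 1%N; apply: summand_power1; apply: summand_trans (iso_summand UW) (sW a).
  by exists 1%N; apply: summand_power1.
- exact/presilting_rigid.
split=> [zM|].
  apply: nzZ0; move: TZ0; rewrite -eqT => /(genF_gen ksR hX)/genP[m [g Hg]].
  apply: (H_zero hX) => h; have [x ->] := Hg h.
  rewrite big1 // => i _; rewrite (_ : x i = 0) ?hom_0 //.
  by apply: homP => z; rewrite [LHS]zM.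
exists #|I|, (fun a => W a : lmodType R); split.
- by move=> a; case: (QW a).
- move=> a b ab Wab; case: (neqV (enum_val a) (enum_val b)).
    by apply: contra ab => /eqP/enum_val_inj ->.
  apply: iso_trans (HW b); apply: iso_trans (iso_sym (HW a)) _.
  exact: iso_H.
- exact: iso_refl.
Qed.

End TorsionClass.
End Main.

Lemma genF_iso (R : pzRingType) (X : fgmod R) : krull_schmidt_ring R ->
  additive_generator X -> forall M N : fgmod R, isomorphic M N -> genF X M = genF X N.
Proof.
move=> ksR hX; suff sub (M N Z : fgmod R) : isomorphic M N -> genF X M Z -> genF X N Z.
  move=> M N iso; apply/predeqP => Z; split; first exact: sub.
  exact/sub/iso_sym.
move=> iso /(genF_gen ksR hX) gM; apply/(genF_gen ksR hX).
apply: (@gen_trans _ _ (Hfg X ksR M) _ _ gM).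
apply: (@gen_summand _ _ (Hfg X ksR N)); last exact: gen_refl (Hfg X ksR N).
exact/H_summand/iso_summand.
Qed.

Lemma isoclass_iso (R : pzRingType) (M N : fgmod R) :
  isoclass M = isoclass N -> isomorphic M N.
Proof. by move=> e; have := iso_refl N; rewrite -[isomorphic N N]/(isoclass N N) -e. Qed.

Theorem theorem1p9 (k : comNzRingType) (L : algType k) (hL : artin_algebra L)
    (X : fgmod L) (hX : additive_generator X)
    (res : forall M : fgmod L, min_resolution X M) (hF : F_admissible res) :
  exists Phi : mclass L -> mclass L,
    (forall M : fgmod L, F_presilt_esp res (isoclass M) ->
       Phi (isoclass M) = genF X M) /\
    bij_on (F_presilt_esp res) (F_tor_preen X) Phi.
Proof.
have finL := artin_algebra_finite hL.
have ksL := finite_krull_schmidt finL.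
have [psi /finite_krull_schmidt ksG] := endo_finite X finL.
pose Phi (C : mclass L) : mclass L := fun Z => exists2 M : fgmod L, C = isoclass M & genF X M Z.
have PhiE (M : fgmod L) : Phi (isoclass M) = genF X M.
  apply/predeqP => Z; split=> [[N /isoclass_iso MN]|gZ]; last by exists M.
  by rewrite (genF_iso ksL hX MN).
exists Phi; split=> [M _|]; first exact: PhiE.
split=> [_ [M [spM pre ->]]|_ _ [M [spM _ ->]] [N [spN _ ->]]|T torT].
- have [[nz _] /(presilting_rigid res)rM _] := spM.
  rewrite PhiE; split=> //; first by exists M => //; apply: (genF_refl ksL hX).
  exact: (genF_torsion ksL hX rM).
- rewrite !PhiE => e; have MN := special_unique ksL hX hF spM spN e.
  apply/predeqP => Z; split; first exact/iso_trans/iso_sym.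
  exact: iso_trans.
- have [M [spM eT]] := torsion_class_special ksL ksG hX hF torT.
  exists (isoclass M); last by rewrite PhiE.
  by exists M; split=> //; rewrite eT; case: torT.
Qed.
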